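(* For any nonempty compact set $X\subseteq\mathbb R^n$ the following are equivalent: (i) $X$ has an outgoing tangent at some point $x\in X$; (ii) the Riesz space $\mathcal R(X)$ is not strongly semisimple, i.e. some principal ideal of $\mathcal R(X)$ is not an intersection of maximal ideals of $\mathcal R(X)$.
   Context: For $y\in\mathbb R^n$ and a linear subspace $L$, $\mathsf{proj}_L(y)$ is the orthogonal projection. Frenet frame of a sequence $\{x_i\}$ converging to $x$: $u_1$ is its Frenet $1$-frame if $x_i\ne x$ for all $i$ and $u_1=\lim_i (x_i-x)/\|x_i-x\|$; a $k$-tuple $(u_1,\ldots,u_k)$ of pairwise orthogonal unit vectors is its Frenet $k$-frame if $(u_1,\ldots,u_{k-1})$ is its Frenet $(k-1)$-frame and $u_k=\lim_i\frac{x_i-x-\mathsf{proj}_{\mathbb Ru_1+\cdots+\mathbb Ru_{k-1}}(x_i-x)}{\|x_i-x-\mathsf{proj}_{\mathbb Ru_1+\cdots+\mathbb Ru_{k-1}}(x_i-x)\|}$ (nonzero denominators). Tangent: for $X\subseteq\mathbb R^n$, $x\in\mathbb R^n$, a $k$-tuple $u=(u_1,\ldots,u_k)$ of pairwise orthogonal unit vectors ($k\ge1$) is a tangent of $X$ at $x$ if $X$ contains a sequence converging to $x$ whose Frenet $k$-frame is $u$. It is outgoing if moreover there are $\lambda_1,\ldots,\lambda_k>0$ such that $C=\operatorname{conv}(x,x+\lambda_1u_1,\ldots,x+\lambda_1u_1+\cdots+\lambda_ku_k)$ and $C'=\operatorname{conv}(x,x+\lambda_1u_1,\ldots,x+\lambda_1u_1+\cdots+\lambda_{k-1}u_{k-1})$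 satisfy $C\cap X=C'\cap X$. $\mathcal R(X)$: choose a closed $n$-cube $K\supseteq X$; $g\colon K\to\mathbb R$ is piecewise linear if there is a triangulation $\Delta$ of $K$ with $g$ continuous and affine linear on each simplex of $\Delta$. $\mathcal R(X)$ is the Riesz space (pointwise operations) of restrictions to $X$ of such functions (independent of $K$). The principal ideal generated by $g$ is $\{f: |f|\le m|g|\text{ for some }m\in\mathbb N\}$. A Riesz space is strongly semisimple if every principal ideal is an intersection of maximal ideals. *)

(* Defs.v *)
From Stdlib Require Import Reals List.
From mathcomp Require Import all_boot.
Set Implicit Arguments. Unset Strict Implicit. Unset Printing Implicit Defensive.
Open Scope R_scope.

Definition vec (n : nat) := 'I_n -> R.

Section Vec.
Variable n : nat.
Implicit Types x y : vec n.

Definition vzero : vec n := fun _ => 0.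
Definition vadd x y : vec n := fun i => x i + y i.
Definition vsub x y : vec n := fun i => x i - y i.
Definition vscale (a : R) x : vec n := fun i => a * x i.
Definition dot x y : R := \big[Rplus/0]_(i < n) (x i * y i).
Definition norm x : R := sqrt (dot x x).

Definition seq_cv (xs : nat -> vec n) (x : vec n) : Prop :=
  forall eps, 0 < eps -> exists N : nat, forall k : nat, (N <= k)%N ->
    norm (vsub (xs k) x) < eps.

Definition orthonormal (us : seq (vec n)) : Prop :=
  forall j l : nat, (j < size us)%N -> (l < size us)%N ->
    dot (nth vzero us j) (nth vzero us l) = (if j == l then 1 else 0).

Definition proj (us : seq (vec n)) (y : vec n) : vec n :=
  \big[vadd/vzero]_(j < size us) vscale (dot y (nth vzero us j)) (nth vzero us j).

Definition frenet_frame (xs : nat -> vec n) (x : vec n) (us : seq (vec n)) : Prop :=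
  (1 <= size us)%N /\ orthonormal us /\
  forall j : nat, (j < size us)%N ->
    let res := fun i => vsub (vsub (xs i) x) (proj (take j us) (vsub (xs i) x)) in
    (forall i, norm (res i) <> 0) /\
    seq_cv (fun i => vscale (/ norm (res i)) (res i)) (nth vzero us j).

Definition tangent (X : vec n -> Prop) (x : vec n) (us : seq (vec n)) : Prop :=
  exists xs : nat -> vec n, (forall i, X (xs i)) /\ seq_cv xs x /\ frenet_frame xs x us.

Definition conv (ps : seq (vec n)) (y : vec n) : Prop :=
  exists w : nat -> R, (forall j, (j < size ps)%N -> 0 <= w j) /\
    \big[Rplus/0]_(j < size ps) w j = 1 /\
    forall i, y i = \big[Rplus/0]_(j < size ps) (w j * (nth vzero ps j) i).

Definition chain_pts (x : vec n) (lam : nat -> R) (us : seq (vec n)) (m : nat)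
  : seq (vec n) :=
  mkseq (fun j => vadd x (\big[vadd/vzero]_(i < j) vscale (lam i) (nth vzero us i)))
        m.+1.

Definition outgoing_tangent (X : vec n -> Prop) (x : vec n) (us : seq (vec n)) : Prop :=
  tangent X x us /\
  exists lam : nat -> R, (forall j, (j < size us)%N -> 0 < lam j) /\
    forall y, (conv (chain_pts x lam us (size us)) y /\ X y) <->
              (conv (chain_pts x lam us (size us).-1) y /\ X y).

Definition open_set (U : vec n -> Prop) : Prop :=
  forall y, U y -> exists eps, 0 < eps /\ forall z, norm (vsub z y) < eps -> U z.

Definition compact_set (X : vec n -> Prop) : Prop :=
  forall (I : Type) (U : I -> vec n -> Prop),
    (forall i, open_set (U i)) -> (forall x, X x -> exists i, U i x) ->
    exists l : list I, forall x, X x -> exists i, List.In i l /\ U i x.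

Definition closed_cube (K : vec n -> Prop) : Prop :=
  exists (c : vec n) (s : R), 0 < s /\
    forall y, K y <-> (forall i, c i <= y i <= c i + s).

Definition aff_indep (vs : seq (vec n)) : Prop :=
  forall c : nat -> R, \big[Rplus/0]_(j < size vs) c j = 0 ->
    (forall i, \big[Rplus/0]_(j < size vs) (c j * (nth vzero vs j) i) = 0) ->
    forall j, (j < size vs)%N -> c j = 0.

(** A triangulation of K: a finite family of (nonempty) simplices, given by
    affinely independent vertex lists, whose union is K and such that any two
    of them intersect in a common face (the convex hull of common vertices,
    possibly empty). *)
Definition triangulation (K : vec n -> Prop) (T : seq (seq (vec n))) : Prop :=
  (forall S, List.In S T -> (1 <= size S)%N /\ aff_indep S) /\
  (forall y, K y <-> exists S, List.In S T /\ conv S y) /\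
  (forall S S', List.In S T -> List.In S' T ->
     exists F : seq (vec n), (forall v, List.In v F -> List.In v S /\ List.In v S') /\
       forall y, (conv S y /\ conv S' y) <-> conv F y).

Definition continuous_on (K : vec n -> Prop) (g : vec n -> R) : Prop :=
  forall y, K y -> forall eps, 0 < eps -> exists delta, 0 < delta /\
    forall z, K z -> norm (vsub z y) < delta -> Rabs (g z - g y) < eps.

Definition affine_on (S : vec n -> Prop) (g : vec n -> R) : Prop :=
  exists (a : vec n) (b : R), forall y, S y -> g y = dot a y + b.

Definition piecewise_linear (K : vec n -> Prop) (g : vec n -> R) : Prop :=
  exists T, triangulation K T /\ continuous_on K g /\
    forall S, List.In S T -> affine_on (conv S) g.

(** The Riesz space R(X) (w.r.t. the cube K ⊇ X): functions on X that are
    restrictions of piecewise linear functions on K; pointwise operations. *)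
Definition pt (X : vec n -> Prop) := {x : vec n | X x}.

Definition RX (X : vec n -> Prop) (K : vec n -> Prop) (f : pt X -> R) : Prop :=
  exists g, piecewise_linear K g /\ forall p : pt X, f p = g (proj1_sig p).

Definition riesz_ideal (X K : vec n -> Prop) (I : (pt X -> R) -> Prop) : Prop :=
  (forall f, I f -> RX K f) /\
  I (fun _ => 0) /\
  (forall f h, I f -> I h -> I (fun p => f p + h p)) /\
  (forall (a : R) f, I f -> I (fun p => a * f p)) /\
  (forall f h, I f -> RX K h -> (forall p, Rabs (h p) <= Rabs (f p)) -> I h).

Definition maximal_ideal (X K : vec n -> Prop) (I : (pt X -> R) -> Prop) : Prop :=
  riesz_ideal K I /\ (exists f, RX K f /\ ~ I f) /\
  forall J, riesz_ideal K J -> (exists f, RX K f /\ ~ J f) ->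
    (forall f, I f -> J f) -> forall f, J f -> I f.

Definition principal_ideal (X K : vec n -> Prop) (g : pt X -> R) (f : pt X -> R)
  : Prop :=
  RX K f /\ exists m : nat, forall p, Rabs (f p) <= INR m * Rabs (g p).

(** Every principal ideal is an intersection of (a family of) maximal ideals
    (the empty intersection being R(X) itself). *)
Definition strongly_semisimple (X K : vec n -> Prop) : Prop :=
  forall g, RX K g ->
    exists F : ((pt X -> R) -> Prop) -> Prop,
      (forall M, F M -> maximal_ideal K M) /\
      forall f, principal_ideal K g f <-> (RX K f /\ forall M, F M -> M f).

End Vec.

(* Main.v *)
(** The maximal ideals of [R(X)] are the point ideals [{f | f x = 0}], x in X, so strong
    semisimplicity fails iff there are nonnegative [f], [g] in [R(X)] with [Z(g)] contained in [Z(f)]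
    on [X] and [f] bounded by no multiple of [g].

    Along a sequence with outgoing tangent [(u_1, ..., u_k)], let [f] be the absolute value of the
    [u_k]-coordinate and [g] a piecewise linear function vanishing exactly on [C]: then [f/g] is
    unbounded, while [C] and [C'] meeting [X] in the same set gives [Z(g)] contained in [Z(f)].
    Conversely, [f/g] is unbounded near some point [x] inside one polyhedral cell on which [f] and [g]
    are affine. Pass to subsequences so as to add Frenet vectors one by one, until the derivative of
    [f] along the last one is nonzero; the derivative of [g] along it must vanish. For
    [lambda_j = eps^j] with [eps] small, [C] lies in the cell, so [g = 0] on [C], hence [f = 0] on the
    intersection of [C] with [X], i.e. the last coordinate vanishes there.

    Membership in [R(X)] is handled through finite covers by polyhedra on which the function is
    affine. A triangulation adapted to finitely many hyperplanes is obtained from one large simplex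
    by repeatedly cutting, at a zero of one of the affine forms, an edge on which it changes sign. *)
Require Import Defs.
From HB Require Import structures.
From Stdlib Require Import Reals List Lra Classical ClassicalEpsilon FunctionalExtensionality.
From mathcomp Require Import all_boot.
Set Implicit Arguments. Unset Strict Implicit. Unset Printing Implicit Defensive.
Open Scope R_scope.

(* [Finite.sort _] and ['I_k] are convertible, but would make sums distinct atoms for [lra]. *)
Ltac slra := intros; simpl Finite.sort in *; lra.
Ltac snra := intros; simpl Finite.sort in *; nra.

(** * Finite sums of real numbers *)

Lemma RplusA : associative Rplus. Proof. by move=> x y z; rewrite Rplus_assoc. Qed.
Lemma RplusC : commutative Rplus. Proof. exact: Rplus_comm. Qed.
Lemma Rplus0x : left_id 0 Rplus. Proof. exact: Rplus_0_l. Qed.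

HB.instance Definition _ := Monoid.isComLaw.Build R 0 Rplus RplusA RplusC Rplus0x.

Notation "\rsum_ ( i < k ) F" := (\big[Rplus/0]_(i < k) F)
  (at level 41, F at level 41, i, k at level 50).

Lemma rsumZ k a (F : 'I_k -> R) : a * (\rsum_(i < k) F i) = \rsum_(i < k) (a * F i).
Proof. by apply: (big_morph (Rmult a)) => [x y|]; ring. Qed.

Lemma rsumD k (F G : 'I_k -> R) :
  \rsum_(i < k) (F i + G i) = \rsum_(i < k) F i + \rsum_(i < k) G i.
Proof. exact: big_split. Qed.

Lemma rsumB k (F G : 'I_k -> R) :
  \rsum_(i < k) (F i - G i) = \rsum_(i < k) F i - \rsum_(i < k) G i.
Proof.
have -> : \rsum_(i < k) F i - \rsum_(i < k) G i =
          \rsum_(i < k) F i + (-1) * \rsum_(i < k) G i by ring.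
by rewrite rsumZ -rsumD; apply: eq_bigr => i _; ring.
Qed.

Lemma rsumS k (F : nat -> R) : \rsum_(i < k.+1) F i = \rsum_(i < k) F i + F k.
Proof. by rewrite big_ord_recr. Qed.

Lemma rsum_const k c : \rsum_(i < k) c = INR k * c.
Proof.
elim: k => [|k IH]; first by rewrite big_ord0 /=; ring.
by rewrite (rsumS k (fun _ => c)) IH S_INR; ring.
Qed.

Lemma rsum_le k (F G : 'I_k -> R) :
  (forall i, F i <= G i) -> \rsum_(i < k) F i <= \rsum_(i < k) G i.
Proof.
move=> le; elim/big_ind2: _ => [|x1 x2 y1 y2 ? ?|i _]; [exact: Rle_refl | slra | exact: le].
Qed.

Lemma rsum_ge0 k (F : 'I_k -> R) : (forall i, 0 <= F i) -> 0 <= \rsum_(i < k) F i.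
Proof.
by move=> le; elim/big_ind: _ => [|x y ? ?|i _]; [exact: Rle_refl | slra | exact: le].
Qed.

Lemma rsum_eq0 k (F : 'I_k -> R) : (forall i, F i = 0) -> \rsum_(i < k) F i = 0.
Proof. by move=> F0; rewrite big1. Qed.

Lemma rsum_ge_term k (F : 'I_k -> R) (i : 'I_k) :
  (forall j, 0 <= F j) -> F i <= \rsum_(j < k) F j.
Proof.
move=> F0; rewrite (bigD1 i) //=.
rewrite -{1}(Rplus_0_r (F i)); apply: Rplus_le_compat_l.
by elim/big_ind: _ => [|x y ? ?|j _]; [exact: Rle_refl | slra | exact: F0].
Qed.

Lemma rsum_sum_eq0 k (F : 'I_k -> R) :
  (forall j, 0 <= F j) -> \rsum_(j < k) F j = 0 -> forall i, F i = 0.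
Proof. move=> F0 s0 i; have := rsum_ge_term i F0; move: (F0 i); slra. Qed.

Lemma rsum_abs k (F : 'I_k -> R) : Rabs (\rsum_(i < k) F i) <= \rsum_(i < k) Rabs (F i).
Proof.
elim/big_ind2: _ => [|x1 x2 y1 y2|i _]; [by rewrite Rabs_R0; apply: Rle_refl | | exact: Rle_refl].
by move=> ? ?; have := Rabs_triang x2 y2; slra.
Qed.

Lemma rsum_delta k v c (G : nat -> R) :
  (v < k)%N -> \rsum_(i < k) ((if i == v :> nat then c else 0) * G i) = c * G v.
Proof.
move=> lt; rewrite (bigD1 (Ordinal lt)) //= eqxx big1 ?Rplus_0_r // => i ne.
have -> : (i == v :> nat) = false by apply/negbTE; move: ne; rewrite -val_eqE.
by ring.
Qed.

Lemma rsum_deltaI k (v : 'I_k) c (G : 'I_k -> R) :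
  \rsum_(i < k) ((if i == v then c else 0) * G i) = c * G v.
Proof.
rewrite (bigD1 v) //= eqxx big1 ?Rplus_0_r // => i ne.
by rewrite (negbTE ne); ring.
Qed.

(** * Vectors and affine functions *)

Section Vectors.
Context (n : nat).
Implicit Types (x y z u v : vec n).

Lemma vec_ext x y : (forall i, x i = y i) -> x = y.
Proof. exact: functional_extensionality. Qed.

Lemma dotC x y : dot x y = dot y x.
Proof. by apply: eq_bigr => i _; ring. Qed.

Lemma dotDl x y z : dot (vadd x y) z = dot x z + dot y z.
Proof. by rewrite /dot -rsumD; apply: eq_bigr => i _; rewrite /vadd; ring. Qed.

Lemma dotBl x y z : dot (vsub x y) z = dot x z - dot y z.
Proof. by rewrite /dot -rsumB; apply: eq_bigr => i _; rewrite /vsub; ring. Qed.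

Lemma dotZl a x z : dot (vscale a x) z = a * dot x z.
Proof. by rewrite /dot rsumZ; apply: eq_bigr => i _; rewrite /vscale; ring. Qed.

Lemma dot0l z : dot (@vzero n) z = 0.
Proof. by rewrite /dot rsum_eq0 // => i; rewrite /vzero; ring. Qed.

Lemma dotDr x y z : dot z (vadd x y) = dot z x + dot z y.
Proof. by rewrite !(dotC z) dotDl. Qed.

Lemma dotBr x y z : dot z (vsub x y) = dot z x - dot z y.
Proof. by rewrite !(dotC z) dotBl. Qed.

Lemma dotZr a x z : dot z (vscale a x) = a * dot z x.
Proof. by rewrite !(dotC z) dotZl. Qed.

Lemma dot_sumr k (F : 'I_k -> vec n) z :
  dot z (\big[@vadd n/@vzero n]_(i < k) F i) = \rsum_(i < k) dot z (F i).
Proof. by apply: (big_morph (dot z)) => [x y|]; rewrite ?dotDr // dotC dot0l. Qed.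

Lemma vsumE k (F : 'I_k -> vec n) c :
  (\big[@vadd n/@vzero n]_(i < k) F i) c = \rsum_(i < k) F i c.
Proof. by apply: (big_morph (fun v : vec n => v c)). Qed.

Lemma dot_ge0 x : 0 <= dot x x.
Proof. by apply: rsum_ge0 => i; snra. Qed.

Lemma norm_ge0 x : 0 <= norm x.
Proof. exact: sqrt_pos. Qed.

Lemma norm_sqr x : norm x * norm x = dot x x.
Proof. exact/sqrt_sqrt/dot_ge0. Qed.

Lemma coord_le_norm x i : Rabs (x i) <= norm x.
Proof.
rewrite -sqrt_Rsqr_abs; apply: sqrt_le_1_alt.
by apply: (@rsum_ge_term n (fun i => x i * x i)) => j; snra.
Qed.

(** Equivalent to the Euclidean norm, but piecewise linear in [x], so that it can enter elements of
    R(X). *)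
Definition norm1 x := \rsum_(i < n) Rabs (x i).

Lemma norm1_ge0 x : 0 <= norm1 x.
Proof. by apply: rsum_ge0 => i; apply: Rabs_pos. Qed.

Lemma norm1_le_norm x : norm1 x <= INR n * norm x.
Proof. by rewrite -rsum_const; apply: rsum_le => i; apply: coord_le_norm. Qed.

Lemma norm_le_norm1 x : norm x <= norm1 x.
Proof.
rewrite -(sqrt_Rsqr (norm1 x)); last exact: norm1_ge0.
apply: sqrt_le_1_alt; rewrite /Rsqr {2}/norm1 rsumZ; apply: rsum_le => i.
have := @rsum_ge_term n (fun i => Rabs (x i)) i (fun j => Rabs_pos (x j)).
rewrite -/(norm1 x) => le; have := Rabs_pos (x i); have := Rabs_mult (x i) (x i).
by rewrite Rabs_pos_eq; snra.
Qed.

Lemma norm1_triangle x y z : norm1 (vsub x z) <= norm1 (vsub x y) + norm1 (vsub y z).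
Proof.
rewrite -rsumD; apply: rsum_le => i; rewrite /vsub.
have -> : x i - z i = (x i - y i) + (y i - z i) by ring.
exact: Rabs_triang.
Qed.

Lemma norm0_eq0 x : norm x = 0 -> forall i, x i = 0.
Proof.
move=> x0 i; have := coord_le_norm x i; rewrite x0 => le.
by have := Rabs_pos (x i); case: (Req_dec (x i) 0) => // /Rabs_pos_lt; slra.
Qed.

(** A weak form of the Cauchy-Schwarz inequality, enough for continuity. *)
Lemma dot_le_norm x y : Rabs (dot x y) <= norm1 x * norm y.
Proof.
apply: Rle_trans (rsum_abs _) _; rewrite /norm1 Rmult_comm rsumZ.
apply: rsum_le => i; rewrite Rabs_mult.
by have := coord_le_norm y i; have := Rabs_pos (x i); snra.
Qed.

Definition affine := (vec n * R)%type.
Definition ev (h : affine) y := dot h.1 y + h.2.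

Lemma ev_continuous (h : affine) y eps : 0 < eps ->
  exists d, 0 < d /\ forall z, norm (vsub z y) < d -> Rabs (ev h z - ev h y) < eps.
Proof.
move=> e0; have A0 := norm1_ge0 h.1; exists (eps / (norm1 h.1 + 1)); split.
  by apply: Rdiv_lt_0_compat; slra.
move=> z lt; rewrite /ev.
have -> : dot h.1 z + h.2 - (dot h.1 y + h.2) = dot h.1 (vsub z y) by rewrite dotBr; ring.
apply: Rle_lt_trans (dot_le_norm _ _) _.
have -> : eps = (norm1 h.1 + 1) * (eps / (norm1 h.1 + 1)) by field; slra.
by have := norm_ge0 (vsub z y); snra.
Qed.

Lemma ev_conv (h : affine) k (w : nat -> R) (p : nat -> vec n) y :
  \rsum_(j < k) w j = 1 -> (forall c, y c = \rsum_(j < k) (w j * p j c)) ->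
  ev h y = \rsum_(j < k) (w j * ev h (p j)).
Proof.
move=> w1 yE; rewrite /ev.
have -> : \rsum_(j < k) (w j * (dot h.1 (p j) + h.2)) =
          \rsum_(j < k) (w j * dot h.1 (p j)) + h.2.
  rewrite -{2}(Rmult_1_r h.2) -w1 rsumZ -rsumD.
  by apply: eq_bigr => j _; ring.
congr (_ + _).
have -> : y = \big[@vadd n/@vzero n]_(j < k) vscale (w j) (p j).
  by apply: vec_ext => c; rewrite vsumE yE.
by rewrite dot_sumr; apply: eq_bigr => j _; rewrite dotZr.
Qed.

End Vectors.

(** * Finite lists: selection, choice and common thresholds *)

Lemma list_filter_ex T (P : T -> Prop) (l : list T) :
  exists l', forall x, In x l' <-> In x l /\ P x.
Proof.
elim: l => [|a l [l' IH]]; first by exists [::] => x /=; tauto.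
case: (classic (P a)) => Pa; last first.
  exists l' => x /=; rewrite IH; split; first by tauto.
  by case=> [[<-|?] ?].
exists (a :: l') => x /=; rewrite IH; split; last by tauto.
by case=> [<-|[? ?]]; tauto.
Qed.

Lemma list_map_ex T S (P : T -> S -> Prop) (l : list T) :
  (forall x, In x l -> exists y, P x y) ->
  exists l', (forall x, In x l -> exists y, In y l' /\ P x y) /\
             (forall y, In y l' -> exists x, In x l /\ P x y).
Proof.
elim: l => [|a l IH] ex; first by exists [::]; split=> x [].
have [|l' [H1 H2]] := IH; first by move=> x xl; apply: ex; right.
have [|b Pab] := ex a; first by left.
exists (b :: l'); split=> [x [<-|/H1[y [? ?]]]|y [<-|/H2[x [? ?]]]].
- by exists b; split; [left|].
- by exists y; split; [right|].
- by exists a; split; [left|].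
- by exists x; split; [right|].
Qed.

(** Thresholds that may be decreased can be replaced by the minimum of finitely many. *)
Lemma list_delta T (P : T -> R -> Prop) (l : list T) :
  (forall x d e, P x d -> 0 < e <= d -> P x e) ->
  (forall x, In x l -> exists d, 0 < d /\ P x d) ->
  exists d, 0 < d /\ forall x, In x l -> P x d.
Proof.
move=> anti; elim: l => [|a l IH] ex; first by exists 1; split; [slra|move=> x []].
have [|d [d0 H]] := IH; first by move=> x xl; apply: ex; right.
have [|e [e0 He]] := ex a; first by left.
have m0 : 0 < Rmin d e by apply: Rmin_pos.
exists (Rmin d e); split=> // x [<-|xl].
  by apply: anti He _; split=> //; apply: Rmin_r.
by apply: anti (H x xl) _; split=> //; apply: Rmin_l.
Qed.

Lemma In_mem (T : eqType) (x : T) (s : seq T) : In x s <-> x \in s.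
Proof.
elim: s => //= a s IH; rewrite inE IH; split=> [[->|->]|/orP[/eqP->|->]].
- by rewrite eqxx.
- by rewrite orbT.
- by left.
- by right.
Qed.

(** * Polyhedra and piecewise affine functions *)

(** The one-dimensional case of elimination: lower bounds [A] and upper bounds [B] for an unknown
    [t] are compatible once they are so in pairs. *)
Lemma separate_lists (A B : list R) :
  (forall a b, In a A -> In b B -> a <= b) ->
  exists t, (forall a, In a A -> a <= t) /\ (forall b, In b B -> t <= b).
Proof.
have minB b0 : exists t, (forall b, In b B -> t <= b) /\ t <= b0 /\ (In t B \/ t = b0).
  elim: B => [|b B [t [H1 [H2 H3]]]]; first by exists b0; split=> //; split; [slra|right].
  exists (Rmin b t); have := Rmin_l b t; have := Rmin_r b t => mr ml; split; [|split].
  - by move=> c [<-//|/H1]; slra.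
  - slra.
  by rewrite /Rmin; case: Rle_dec => _; [left; left | case: H3 => ?; [left; right | right]].
elim: A => [|a A IH] le.
  by have [t [H _]] := minB 0; exists t; split=> // ? [].
have [|t [H1 H2]] := IH; first by move=> c b cA bB; apply: le => //; right.
have [ta|at_] := Rle_dec a t.
  by exists t; split=> // c [<-|/H1].
exists a; split=> [c [<-|/H1]|b bB]; [slra | slra | by apply: le => //; left].
Qed.

(* Fourier-Motzkin elimination of the variable [t], over an abstract type [A] of functions on [Y]
   closed under linear combinations. *)
Lemma eliminate_variable (A Y : Type) (E : A -> Y -> R) (comb : R -> R -> A -> A -> A)
    (combE : forall a b f g y, E (comb a b f g) y = a * E f y + b * E g y)
    (l : list (A * R)) :
  exists l' : list A, forall y,
    (exists t, forall q, In q l -> 0 <= E q.1 y + q.2 * t) <->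
    (forall f, In f l' -> 0 <= E f y).
Proof.
have [l0 H0] := list_filter_ex (fun q : A * R => q.2 = 0) l.
have [lp Hp] := list_filter_ex (fun q : A * R => 0 < q.2) l.
have [lm Hm] := list_filter_ex (fun q : A * R => q.2 < 0) l.
(* A constraint with positive and one with negative coefficient of [t] are combined with positive
   multipliers for which [t] cancels. *)
pose pairf (q : (A * R) * (A * R)) := comb (- q.2.2) (q.1.2) q.1.1 q.2.1.
exists (List.map fst l0 ++ List.map pairf (list_prod lp lm))%list => y; split.
  move=> [t Ht] f /in_app_iff[|] /in_map_iff.
    by case=> q [<- /H0[ql q0]]; have := Ht q ql; rewrite q0; slra.
  case=> -[p m] [<- /in_prod_iff[/Hp[/Ht pl p0] /Hm[/Ht ml m0]]].
  by rewrite /pairf combE /=; nra.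
move=> H.
have [|t [H1 H2]] := @separate_lists
    (List.map (fun q : A * R => - E q.1 y / q.2) lp) (List.map (fun q : A * R => - E q.1 y / q.2) lm).
  move=> a b /in_map_iff[p [<- pl]] /in_map_iff[m [<- ml]].
  have [_ p0] := (Hp p).1 pl; have [_ m0] := (Hm m).1 ml.
  have : 0 <= E (pairf (p, m)) y.
    apply: H; apply/in_app_iff; right; apply/in_map_iff; exists (p, m); split=> //.
    exact/in_prod_iff.
  rewrite /pairf combE /= => le.
  have [u e1] : exists u, E p.1 y = p.2 * u by exists (E p.1 y / p.2); field; lra.
  have [v e2] : exists v, E m.1 y = m.2 * v by exists (E m.1 y / m.2); field; lra.
  have -> : - E p.1 y / p.2 = - u by rewrite e1; field; lra.
  have -> : - E m.1 y / m.2 = - v by rewrite e2; field; lra.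
  have pm : 0 < p.2 * - m.2 by nra.
  by rewrite e1 e2 in le; nra.
exists t => q ql; case: (Rtotal_order q.2 0) => [lt|[e|gt]].
- have : t <= - E q.1 y / q.2.
    by apply: H2; apply/in_map_iff; exists q; split=> //; apply/Hm.
  have e1 : E q.1 y = - q.2 * (- E q.1 y / q.2) by field; lra.
  by nra.
- rewrite e Rmult_0_l Rplus_0_r; apply: H; apply/in_app_iff; left.
  by apply/in_map_iff; exists q; split=> //; apply/H0.
- have : - E q.1 y / q.2 <= t.
    by apply: H1; apply/in_map_iff; exists q; split=> //; apply/Hp.
  have e1 : E q.1 y = - q.2 * (- E q.1 y / q.2) by field; lra.
  by nra.
Qed.

Section Polyhedra.
Context (n : nat).
Implicit Types (x y z u v : vec n) (h : affine n) (K : vec n -> Prop).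

Definition polyhedron (l : list (affine n)) y := forall h, In h l -> 0 <= ev h y.

Definition affine_comb a b h h' : affine n :=
  (vadd (vscale a h.1) (vscale b h'.1), a * h.2 + b * h'.2).

Lemma ev_comb a b h h' y : ev (affine_comb a b h h') y = a * ev h y + b * ev h' y.
Proof. by rewrite /ev /= dotDl !dotZl; ring. Qed.

Lemma polyhedron_app l l' y : polyhedron (l ++ l')%list y <-> polyhedron l y /\ polyhedron l' y.
Proof.
split=> [H|[H H'] h /in_app_iff[/H|/H']//].
by split=> h hl; apply: H; apply/in_app_iff; [left|right].
Qed.

Lemma polyhedron_projection k (l : list (affine n * (nat -> R))) :
  exists l', forall y,
    (exists w : nat -> R, forall q, In q l -> 0 <= ev q.1 y + \rsum_(j < k) (q.2 j * w j)) <->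
    polyhedron l' y.
Proof.
elim: k l => [|k IH] l.
  exists (List.map fst l) => y; split.
    by move=> [w H] h /in_map_iff[q [<- /H]]; rewrite big_ord0 Rplus_0_r.
  move=> H; exists (fun _ => 0) => q ql; rewrite big_ord0 Rplus_0_r.
  by apply: H; apply/in_map_iff; exists q.
(* Constraints are read as functions of [y] and the first [k] variables, so that
   [eliminate_variable] removes the variable of index [k]. *)
pose E (q : affine n * (nat -> R)) (yw : vec n * (nat -> R)) :=
  ev q.1 yw.1 + \rsum_(j < k) (q.2 j * yw.2 j).
pose cb a b (q q' : affine n * (nat -> R)) :=
  (affine_comb a b q.1 q'.1, fun j => a * q.2 j + b * q'.2 j).
have cbE a b q q' yw : E (cb a b q q') yw = a * E q yw + b * E q' yw.
  rewrite /E /= ev_comb !Rmult_plus_distr_l !rsumZ.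
  have -> : \rsum_(j < k) ((a * q.2 j + b * q'.2 j) * yw.2 j) =
    \rsum_(j < k) (a * (q.2 j * yw.2 j)) + \rsum_(j < k) (b * (q'.2 j * yw.2 j)).
    by rewrite -rsumD; apply: eq_bigr => j _; ring.
  by ring.
have [l1 H1] := eliminate_variable cbE (List.map (fun q => (q, q.2 k)) l).
have [l2 H2] := IH l1; exists l2 => y; rewrite -H2; split.
  move=> [w H]; exists w => q; apply: (H1 (y, w)).1 q; exists (w k).
  move=> q /in_map_iff[r [<- /H]] /=.
  by rewrite (rsumS k (fun j => r.2 j * w j)) /E /=; slra.
move=> [w H]; have [t Ht] := (H1 (y, w)).2 H.
exists (fun j => if j == k then t else w j) => q ql.
have := Ht (q, q.2 k) (in_map (fun q => (q, q.2 k)) _ _ ql).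
rewrite (rsumS k (fun j => q.2 j * (if j == k then t else w j))) eqxx /E /=.
have -> : \rsum_(j < k) (q.2 j * (if j == k :> nat then t else w j)) = \rsum_(j < k) (q.2 j * w j).
  by apply: eq_bigr => j _; rewrite ltn_eqF.
by slra.
Qed.

(** The pairs of a point and its convex weights form a polyhedron; the hull is its projection along
    the weights. *)
Lemma conv_polyhedron (ps : seq (vec n)) : exists l, forall y, conv ps y <-> polyhedron l y.
Proof.
pose k := size ps.
pose delta (i : nat) (j : nat) : R := if j == i then 1 else 0.
pose e (i : 'I_n) : vec n := fun c => if c == i then 1 else 0.
have ee i y : dot (e i) y = y i by rewrite /dot /e rsum_deltaI Rmult_1_l.
(* [c1] says that the weights are nonnegative, [c2] that their sum is 1 (two inequalities), [c3] and
   [c4] that each coordinate of [y] equals that of the weighted sum. *)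
pose c1 := List.map (fun i => ((@vzero n, 0), delta i)) (iota 0 k).
pose c2 := [:: ((@vzero n, -1), fun _ : nat => 1); ((@vzero n, 1), fun _ : nat => -1)].
pose c3 := List.map (fun i => ((e i, 0), fun j => - (nth (@vzero n) ps j) i)) (enum 'I_n).
pose c4 := List.map (fun i => ((vscale (-1) (e i), 0), fun j => (nth (@vzero n) ps j) i)) (enum 'I_n).
have In_iota i : In i (iota 0 k) <-> (i < k)%N by rewrite In_mem mem_iota.
have In_enum (i : 'I_n) : In i (enum 'I_n) by apply/In_mem; rewrite mem_enum.
have [l Hl] := polyhedron_projection k (c1 ++ (c2 ++ (c3 ++ c4)))%list.
exists l => y; rewrite -Hl; split.
  move=> [w [w0 [w1 wE]]]; exists w => q /in_app_iff[|/in_app_iff[|/in_app_iff[]]].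
  - move=> /in_map_iff[i [<- /In_iota ik]] /=.
    rewrite /ev /= dot0l rsum_delta //; have := w0 i ik; slra.
  - case=> [<-|[<-|[]]] /=; rewrite -rsumZ w1 /ev /= dot0l; lra.
  - move=> /in_map_iff[i [<- _]] /=; rewrite /ev /= ee wE.
    rewrite Rplus_0_r -rsumD rsum_eq0 => [|j]; [exact: Rle_refl | rewrite /k; ring].
  - move=> /in_map_iff[i [<- _]] /=; rewrite /ev /= dotZl ee wE.
    rewrite Rplus_0_r rsumZ -rsumD rsum_eq0 => [|j /=]; [exact: Rle_refl | rewrite /k; ring].
move=> [w H]; exists w; split; [|split].
- move=> j jk; have := H ((@vzero n, 0), delta j); rewrite /ev /= dot0l rsum_delta //.
  have in1 : In (vzero (n:=n), 0, delta j) (c1 ++ c2 ++ c3 ++ c4)%list.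
    by apply/in_app_iff; left; apply/in_map_iff; exists j; split=> //; apply/In_iota.
  by move/(_ in1); slra.
- have inl q : In q c2 -> In q (c1 ++ c2 ++ c3 ++ c4)%list.
    by move=> qc; apply/in_app_iff; right; apply/in_app_iff; left.
  have := H _ (inl _ (or_introl erefl)); have := H _ (inl _ (or_intror (or_introl erefl))).
  by rewrite /ev /= dot0l -!rsumZ -/k; slra.
move=> i.
have [in3 in4] : In (e i, 0, fun j => - (nth (@vzero n) ps j) i) (c1 ++ c2 ++ c3 ++ c4)%list /\
       In (vscale (-1) (e i), 0, fun j => (nth (@vzero n) ps j) i) (c1 ++ c2 ++ c3 ++ c4)%list.
  split; do 2![apply/in_app_iff; right]; apply/in_app_iff; [left|right];
  by apply/in_map_iff; exists i; split.
have := H _ in3; have := H _ in4; rewrite /ev /= dotZl ee.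
have -> : \rsum_(j < k) (- nth (vzero (n:=n)) ps j i * w j) =
     (-1) * \rsum_(j < k) (w j * nth (vzero (n:=n)) ps j i).
  by rewrite rsumZ; apply: eq_bigr => j _; ring.
have -> : \rsum_(j < k) (nth (vzero (n:=n)) ps j i * w j) =
     \rsum_(j < k) (w j * nth (vzero (n:=n)) ps j i).
  by apply: eq_bigr => j _; ring.
by rewrite -/k; slra.
Qed.

(** Cells may overlap arbitrarily, without any common-face condition, so that closure under the
    Riesz operations only takes intersecting and cutting cells. Equivalence with [piecewise_linear]
    on a cube is [piecewise_linear_cellwise] and [cellwise_piecewise_linear]. *)
Definition cellwise_affine K (g : vec n -> R) :=
  exists cs : list (list (affine n) * affine n),
    (forall y, K y -> exists c, In c cs /\ polyhedron c.1 y) /\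
    (forall y c, In c cs -> K y -> polyhedron c.1 y -> g y = ev c.2 y).

Lemma piecewise_linear_cellwise K g : piecewise_linear K g -> cellwise_affine K g.
Proof.
move=> [T [[_ [cov _]] [_ aff]]].
have [S ST|cs [H1 H2]] := list_map_ex (l := T)
  (P := fun S c => (forall y, conv S y <-> polyhedron c.1 y) /\ forall y, conv S y -> g y = ev c.2 y).
  have [l Hl] := conv_polyhedron S; have [a [b H]] := aff S ST.
  by exists (l, (a, b)).
exists cs; split.
  move=> y /cov[S [/H1[c [cin [cE _]]] Sy]]; exists c; split=> //; exact/cE.
by move=> y c /H2[S [ST [SE H]]] _ /SE/H.
Qed.

Lemma polyhedron_closed l y : ~ polyhedron l y ->
  exists d, 0 < d /\ forall z, norm (vsub z y) < d -> ~ polyhedron l z.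
Proof.
move=> Hn; have [h Hh] : exists h, ~ (In h l -> 0 <= ev h y) by exact: not_all_ex_not.
have [hl neg] := imply_to_and _ _ Hh.
have [|d [d0 H]] := @ev_continuous n h y (- ev h y); first by lra.
exists d; split=> // z /H lt /(_ h hl) ge.
by move: lt; rewrite /Rabs; case: Rcase_abs; slra.
Qed.

(** Of the finitely many closed cells, those missing [y] also miss a neighbourhood of [y]; on each
    of the others [g] is affine up to [y] itself. *)
Lemma cellwise_continuous K g : cellwise_affine K g -> continuous_on K g.
Proof.
move=> [cs [cov aff]] y Ky eps e0.
have [c d e H [_ le] z Kz lt|c ccs|d [d0 H]] := @list_delta _ (fun c d => forall z, K z -> norm
    (vsub z y) < d ->
     polyhedron c.1 z -> Rabs (g z - g y) < eps) cs.
- by apply: H => //; lra.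
- case: (classic (polyhedron c.1 y)) => cy.
    have [d [d0 H]] := @ev_continuous n c.2 y eps e0.
    by exists d; split=> // z Kz lt cz; rewrite !(aff _ c) //; apply: H.
  have [d [d0 H]] := polyhedron_closed cy.
  by exists d; split=> // z Kz /H.
by exists d; split=> // z Kz lt; have [c [ccs cz]] := cov z Kz; apply: H ccs _ _ _ _.
Qed.

Lemma cellwise_comb K a b f g : cellwise_affine K f -> cellwise_affine K g ->
  cellwise_affine K (fun y => a * f y + b * g y).
Proof.
move=> [cs [cov aff]] [cs' [cov' aff']].
exists (List.map (fun c => ((c.1.1 ++ c.2.1)%list, affine_comb a b c.1.2 c.2.2)) (list_prod cs cs')).
split=> y.
  move=> Ky; have [c [cin cy]] := cov y Ky; have [c' [cin' cy']] := cov' y Ky.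
  eexists; split; first by apply/in_map_iff; exists (c, c'); split; [reflexivity | apply/in_prod_iff].
  by apply/polyhedron_app.
move=> _ /in_map_iff[[c c'] [<- /in_prod_iff[cin cin']]] Ky /= /polyhedron_app[cy cy'].
by rewrite ev_comb (aff _ c) // (aff' _ c').
Qed.

Lemma cellwise_affineI K h : cellwise_affine K (ev h).
Proof.
exists [:: ([::], h)]; split=> [y _|y c [<-|[]] //].
by exists ([::], h); split; [left | move=> ? []].
Qed.

Lemma cellwise_ext K f g : (forall y, f y = g y) -> cellwise_affine K f -> cellwise_affine K g.
Proof. by move=> /functional_extensionality ->. Qed.

Lemma cellwise_abs K f : cellwise_affine K f -> cellwise_affine K (fun y => Rabs (f y)).
Proof.
move=> [cs [cov aff]]; pose neg h := affine_comb (-1) 0 h h.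
have negE h y : ev (neg h) y = - ev h y by rewrite ev_comb; ring.
(* Each cell is cut along the zero set of its affine form. *)
exists (List.map (fun c => (c.2 :: c.1, c.2)) cs ++ List.map (fun c => (neg c.2 :: c.1, neg c.2))
    cs)%list.
split=> y.
  move=> Ky; have [c [cin cy]] := cov y Ky.
  case: (Rle_dec 0 (ev c.2 y)) => le.
    eexists; split; first by apply/in_app_iff; left; apply/in_map_iff; exists c.
    by move=> h [<-|/cy].
  eexists; split; first by apply/in_app_iff; right; apply/in_map_iff; exists c.
  by move=> h [<-|/cy//]; rewrite negE; lra.
move=> c /in_app_iff[] /in_map_iff[d [<- din]] Ky /= H;
  rewrite (aff y d) //; try by move=> h hd; apply: H; right.
- by rewrite Rabs_pos_eq //; apply: H; left.
- by rewrite negE -Rabs_Ropp Rabs_pos_eq // -negE; apply: H; left.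
Qed.

Lemma cellwise_const K c : cellwise_affine K (fun _ => c).
Proof.
by apply: cellwise_ext (cellwise_affineI K (@vzero n, c)) => y; rewrite /ev /= dot0l Rplus_0_l.
Qed.

Lemma cellwise_coord K i : cellwise_affine K (fun y => y i).
Proof.
apply: cellwise_ext (cellwise_affineI K ((fun c => if c == i then 1 else 0), 0)) => y.
by rewrite /ev /= /dot rsum_deltaI; ring.
Qed.

Lemma cellwise_add K f g : cellwise_affine K f -> cellwise_affine K g ->
  cellwise_affine K (fun y => f y + g y).
Proof. by move=> F G; apply: cellwise_ext (cellwise_comb 1 1 F G) => y; ring. Qed.

Lemma cellwise_scale K a f : cellwise_affine K f -> cellwise_affine K (fun y => a * f y).
Proof. by move=> F; apply: cellwise_ext (cellwise_comb a 0 F F) => y; ring. Qed.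

Lemma cellwise_sub K f g : cellwise_affine K f -> cellwise_affine K g ->
  cellwise_affine K (fun y => f y - g y).
Proof. by move=> F G; apply: cellwise_ext (cellwise_comb 1 (-1) F G) => y; ring. Qed.

Lemma cellwise_sum K k (F : 'I_k -> vec n -> R) : (forall i, cellwise_affine K (F i)) ->
  cellwise_affine K (fun y => \rsum_(i < k) F i y).
Proof.
move=> H; elim: k F H => [|k IH] F H.
  by apply: cellwise_ext (cellwise_const K 0) => y; rewrite big_ord0.
apply: cellwise_ext (cellwise_add (IH _ _) (H ord_max)) => [y|]; first by rewrite big_ord_recr.
by move=> i; apply: H.
Qed.

Lemma cellwise_max0 K f : cellwise_affine K f -> cellwise_affine K (fun y => Rmax 0 (f y)).
Proof.
move=> F; apply: cellwise_ext (cellwise_comb (/2) (/2) F (cellwise_abs F)) => y.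
by rewrite /Rmax /Rabs; case: Rle_dec; case: Rcase_abs; slra.
Qed.

End Polyhedra.

(** * Triangulations adapted to hyperplanes *)

Section Complexes.
Context (n : nat).
Implicit Types (x y z : vec n) (h : affine n) (K : vec n -> Prop).
Implicit Types (p : nat -> vec n) (S : seq nat) (T : seq (seq nat)) (N : nat).

Definition supported S (a : nat -> R) := forall i, i \notin S -> a i = 0.

(** Barycentric coordinates, extended by zero to all indices so that coordinates in different
    simplices can be compared. *)
Definition weight N S (a : nat -> R) :=
  (forall i, 0 <= a i) /\ supported S a /\ \rsum_(i < N) a i = 1.

Definition realize N p (a : nat -> R) : vec n := fun c => \rsum_(i < N) (a i * p i c).

(* An abstract simplicial complex on the vertices [0 .. N-1] placed at the points [p i]: uniqueness of
   barycentric coordinates across all simplices encodes both affine independence and the common-face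
   condition. *)
Definition complex N p T :=
  (forall S i, S \in T -> i \in S -> (i < N)%N) /\
  (forall S S' a b, S \in T -> S' \in T -> weight N S a -> weight N S' b ->
     realize N p a = realize N p b -> forall i, a i = b i).

Definition covers N p T K :=
  forall y, K y -> exists S a, [/\ S \in T, weight N S a & realize N p a = y].

Definition one_sided h p S :=
  forall v w, v \in S -> w \in S -> 0 < ev h (p v) -> ev h (p w) < 0 -> False.

Lemma complex_lt N p T S i : complex N p T -> S \in T -> i \in S -> (i < N)%N.
Proof. by move=> [H _]; apply: H. Qed.

Lemma ev_realize N h p S a : weight N S a ->
  ev h (realize N p a) = \rsum_(i < N) (a i * ev h (p i)).
Proof. by move=> [_ [_ a1]]; apply: ev_conv. Qed.

Lemma ev_realize_ge0 N h p S a : weight N S a ->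
  (forall i, i \in S -> 0 <= ev h (p i)) -> 0 <= ev h (realize N p a).
Proof.
move=> wa H; rewrite (ev_realize _ _ wa); case: wa => a0 [sa _].
apply: rsum_ge0 => i; have [iS|niS] := boolP (nat_of_ord i \in S).
  by apply: Rmult_le_pos => //; apply: H.
by rewrite sa // Rmult_0_l; apply: Rle_refl.
Qed.

(** A negative value at a vertex of positive weight would make all terms in the expansion of [h]
    nonpositive and one of them negative. *)
Lemma one_sided_vertex N h p S a i : weight N S a -> one_sided h p S ->
  0 <= ev h (realize N p a) -> (i < N)%N -> 0 < a i -> 0 <= ev h (p i).
Proof.
move=> wa os; rewrite (ev_realize _ _ wa); case: wa => a0 [sa _] ge0 iN ai0.
case: (Rle_lt_dec 0 (ev h (p i))) => // neg; exfalso.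
have iS : i \in S by apply/negPn/negP => /sa; lra.
have pos (j : 'I_N) : 0 <= - (a j * ev h (p j)).
  have [jS|/sa->] := boolP (nat_of_ord j \in S); last lra.
  case: (Rlt_le_dec 0 (ev h (p j))) => [/(os j i jS iS)/(_ neg)//|le].
  by have := a0 j; snra.
have := rsum_ge_term (Ordinal iN) pos => /=.
have -> : \rsum_(j < N) (- (a j * ev h (p j))) = (-1) * \rsum_(j < N) (a j * ev h (p j)).
  by rewrite rsumZ; apply: eq_bigr => j _; ring.
have : 0 < a i * - ev h (p i) by apply: Rmult_lt_0_compat; lra.
by slra.
Qed.

(** * Stellar subdivision of an edge *)

Section EdgeSplit.
Context (N : nat) (p : nat -> vec n) (T : seq (seq nat)) (v w : nat) (t : R).
Hypotheses (cT : complex N p T) (vw : v != w) (vN : (v < N)%N) (wN : (w < N)%N) (t01 : 0 < t < 1).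

Let m : vec n := vadd (vscale (1 - t) (p v)) (vscale t (p w)).
Let p' (i : nat) := if i == N then m else p i.
Let split S := if (v \in S) && (w \in S)
  then [:: N :: filter (predC1 v) S; N :: filter (predC1 w) S] else [:: S].
Let T' := flatten (map split T).

(* Barycentric coordinates before the split: the weight of the new vertex [N] is distributed to [v]
   and [w]. *)
Let push (a : nat -> R) (i : nat) := if i == N then 0 else
  a i + (if i == v then (1 - t) * a N else 0) + (if i == w then t * a N else 0).

Lemma splitP S' : S' \in T' -> exists S, S \in T /\
  ((S' = S /\ ~~ ((v \in S) && (w \in S))) \/
   [/\ v \in S, w \in S & S' = N :: filter (predC1 v) S \/ S' = N :: filter (predC1 w) S]).
Proof.
move=> /flatten_mapP[S ST]; rewrite /split; case: ifP => [/andP[vS wS]|no].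
  rewrite !inE => in_; exists S; split=> //; right; split=> //.
  by case/orP: in_ => /eqP->; [left|right].
by rewrite inE => /eqP->; exists S; split=> //; left; rewrite no.
Qed.

Lemma split_vertex S' : S' \in T' -> exists S, S \in T /\
  forall i : nat, i \in S' -> [/\ i = N, v \in S & w \in S] \/ (i != N /\ i \in S).
Proof.
move=> /splitP[S [ST H]]; exists S; split=> // i iS'.
have lt := complex_lt cT ST; case: H => [[e _]|[vS wS H]].
  by right; rewrite e in iS'; split=> //; rewrite ltn_eqF // lt.
case: H => e; move: iS'; rewrite e inE mem_filter => /orP[/eqP->|/andP[_ iS]];
  by [left | right; split=> //; rewrite ltn_eqF // lt].
Qed.

Lemma split_edge S' : S' \in T' -> ~~ ((v \in S') && (w \in S')).
Proof.
by move=> /splitP[S [ST [[-> //]|[vS wS [->|->]]]]];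
  rewrite !inE !mem_filter /= (ltn_eqF vN) (ltn_eqF wN) eqxx ?andbF.
Qed.

Lemma rsum_push (G : nat -> R) a :
  \rsum_(i < N) (push a i * G i) =
  \rsum_(i < N) (a i * G i) + a N * ((1 - t) * G v + t * G w).
Proof.
rewrite Rmult_plus_distr_l.
have -> : a N * ((1 - t) * G v) = (1 - t) * a N * G v by ring.
have -> : a N * (t * G w) = t * a N * G w by ring.
rewrite -(rsum_delta _ G vN) -(rsum_delta _ G wN) -!rsumD.
by apply: eq_bigr => i _; rewrite /push ltn_eqF //; ring.
Qed.

Lemma realize_push a : realize N p (push a) = realize N.+1 p' a.
Proof.
apply: vec_ext => c; rewrite /realize (rsumS _ (fun i => a i * p' i c)).
rewrite (rsum_push (fun i => p i c)) /p' eqxx; congr (_ + _).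
by apply: eq_bigr => i _; rewrite ltn_eqF.
Qed.

Lemma rsum_push1 a : \rsum_(i < N) push a i = \rsum_(i < N.+1) a i.
Proof.
have := rsum_push (fun _ => 1) a; rewrite rsumS.
have -> : (1 - t) * 1 + t * 1 = 1 by ring.
rewrite Rmult_1_r.
have -> : \rsum_(i < N) (a i * 1) = \rsum_(i < N) a i.
  by apply: eq_bigr => i _; ring.
by move=> <-; apply: eq_bigr => i _; ring.
Qed.

Lemma weight_push S' a : S' \in T' -> weight N.+1 S' a ->
  exists2 S, S \in T & weight N S (push a).
Proof.
move=> S'T' [a0 [sa a1]]; have [S [ST H]] := split_vertex S'T'; exists S => //.
split; [|split; last by rewrite rsum_push1].
  move=> i; rewrite /push; case: ifP => _; first by lra.
  by have := a0 i; have := a0 N; case: ifP => _; case: ifP => _; snra.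
(* If the new vertex carries weight, its simplex comes from one containing both [v] and [w], which
   may then receive that weight. *)
have aN : a N = 0 \/ (v \in S /\ w \in S).
  have [NS'|/sa->] := boolP (N \in S'); last by left.
  by right; case: (H N NS') => [[]|[/eqP]].
move=> i niS; rewrite /push; case: ifP => // /negbT iN.
have -> : a i = 0.
  by apply: sa; apply/negP => /H[[e]|[_]]; [rewrite e eqxx in iN | exact/negP].
case: aN => [->|[vS wS]]; first by case: ifP; case: ifP; intros; ring.
have -> : (i == v) = false by apply/eqP => e; rewrite e vS in niS.
have -> : (i == w) = false by apply/eqP => e; rewrite e wS in niS.
by ring.
Qed.

Lemma weight_edge S' a : S' \in T' -> weight N.+1 S' a -> a v = 0 \/ a w = 0.
Proof.
move=> /split_edge; rewrite negb_and => /orP[ni|ni] [_ [sa _]].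
  by left; apply: sa.
by right; apply: sa.
Qed.

(* In terms of the old weights [a], the new vertex has weight [min (a v / (1 - t)) (a w / t)],
   because no new simplex contains both [v] and [w]. *)
Lemma push_inj S1 S2 a b : S1 \in T' -> S2 \in T' -> weight N.+1 S1 a -> weight N.+1 S2 b ->
  (forall i, push a i = push b i) -> forall i, a i = b i.
Proof.
move=> S1T S2T wa wb e.
have ab : a N = b N.
  have wv : w != v by rewrite eq_sym.
  have := e v; have := e w.
  rewrite /push !eqxx (negbTE vw) (negbTE wv) (ltn_eqF vN) (ltn_eqF wN).
  have := wa.1 v; have := wa.1 w; have := wb.1 v; have := wb.1 w.
  by case: (weight_edge S1T wa) => ->; case: (weight_edge S2T wb) => ->; intros; nra.
move=> i; have := e i; rewrite /push ab; have [->//|_] := eqVneq i N.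
by slra.
Qed.

(** [push] reduces uniqueness of coordinates to the old complex, and [push_inj] brings it back. *)
Lemma complex_split : complex N.+1 p' T'.
Proof.
split=> [S' i S'T' iS'|S1 S2 a b S1T S2T wa wb e].
  have [S [ST /(_ i iS')[[->//]|[_ iS]]]] := split_vertex S'T'.
  by apply: ltnW; apply: complex_lt cT ST iS.
have [S1' S1'T wa'] := weight_push S1T wa; have [S2' S2'T wb'] := weight_push S2T wb.
apply: (push_inj S1T S2T) => //; apply: (cT.2 S1' S2') => //.
by rewrite !realize_push.
Qed.

Lemma covers_split K : covers N p T K -> covers N.+1 p' T' K.
Proof.
move=> cov y /cov[S [a [ST [a0 [sa a1]] <-]]].
have aN : a N = 0 by apply: sa; apply/negP => /(complex_lt cT ST); rewrite ltnn.
have [vwS|nvwS] := boolP ((v \in S) && (w \in S)); last first.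
  exists S, a; split.
  - by apply/flatten_mapP; exists S => //; rewrite /split (negbTE nvwS) inE.
  - by split=> //; split=> //; rewrite rsumS aN Rplus_0_r.
  apply: vec_ext => c; rewrite /realize (rsumS _ (fun i => a i * p' i c)) aN Rmult_0_l Rplus_0_r.
  by apply: eq_bigr => i _; rewrite /p' ltn_eqF.
(* The largest weight that the new vertex can take from [v] and [w] in the proportion [1 - t] to
   [t]. It exhausts one of them, and the point lies in the half of the simplex without that
   vertex. *)
pose d := Rmin (a v / (1 - t)) (a w / t).
have dv : (1 - t) * d <= a v.
  have -> : a v = (1 - t) * (a v / (1 - t)) by field; lra.
  by apply: Rmult_le_compat_l; [lra | apply: Rmin_l].
have dw : t * d <= a w.
  have -> : a w = t * (a w / t) by field; lra.
  by apply: Rmult_le_compat_l; [lra | apply: Rmin_r].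
have d0 : 0 <= d.
  by apply: Rmin_glb; apply: Rle_mult_inv_pos => //; lra.
have dd : a v - (1 - t) * d = 0 \/ a w - t * d = 0.
  by rewrite /d /Rmin; case: Rle_dec => _; [left|right]; field; lra.
pose b (i : nat) := if i == N then d else
  a i - (if i == v then (1 - t) * d else 0) - (if i == w then t * d else 0).
have bN : b N = d by rewrite /b eqxx.
have pb i : push b i = a i.
  rewrite /push bN /b; have [->//|_] := eqVneq i N.
  by case: ifP; case: ifP; intros; ring.
have sb i : i \notin N :: S -> b i = 0.
  rewrite inE negb_or /b => /andP[/negbTE-> niS]; rewrite sa //.
  have -> : (i == v) = false by apply/eqP => e; rewrite e (andP vwS).1 in niS.
  have -> : (i == w) = false by apply/eqP => e; rewrite e (andP vwS).2 in niS.
  by ring.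
have b0 i : 0 <= b i.
  rewrite /b; case: ifP => // _; have := a0 i.
  have [->|_] := eqVneq i v; first by rewrite (negbTE vw); slra.
  by have [->|_] := eqVneq i w; slra.
have bv : b v = a v - (1 - t) * d by rewrite /b ltn_eqF // eqxx (negbTE vw) Rminus_0_r.
have bw : b w = a w - t * d.
  by rewrite /b ltn_eqF // eqxx eq_sym (negbTE vw) Rminus_0_r.
have b1 : \rsum_(i < N.+1) b i = 1.
  by rewrite -rsum_push1 -a1; apply: eq_bigr => i _; apply: pb.
have rb : realize N.+1 p' b = realize N p a.
  by rewrite -realize_push; congr realize; apply: functional_extensionality.
have [u uS bu] : exists2 u, (N :: filter (predC1 u) S) \in T' & b u = 0.
  case: dd => d_; [exists v; last by rewrite bv | exists w; last by rewrite bw];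
  by apply/flatten_mapP; exists S => //; rewrite /split vwS !inE eqxx ?orbT.
exists (N :: filter (predC1 u) S), b; split=> //; split=> //; split=> // i.
rewrite inE mem_filter /= negb_or negb_and negbK => /andP[iN /orP[/eqP->//|niS]].
by apply: sb; rewrite inE negb_or iN.
Qed.

(** The value of [h] at the new vertex is a convex combination of those at [v] and [w], so its sign,
    if any, already occurs at one of these. *)
Lemma one_sided_split h :
  (forall S, S \in T -> one_sided h p S) -> forall S', S' \in T' -> one_sided h p' S'.
Proof.
move=> os S' S'T' i j iS' jS'; have [S [ST H]] := split_vertex S'T'.
have em : ev h m = (1 - t) * ev h (p v) + t * ev h (p w).
  by rewrite /ev /m dotDr !dotZr; ring.
rewrite /p'; case: (H i iS') => [[-> vS wS]|[/negbTE-> iS]];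
  case: (H j jS') => [[-> vS' wS']|[/negbTE-> jS]]; rewrite ?eqxx.
- by lra.
- rewrite em => pos neg; case: (Rlt_dec 0 (ev h (p v))) => [/(os S ST v j vS jS)/(_ neg)//|nv].
  case: (Rlt_dec 0 (ev h (p w))) => [/(os S ST w j wS jS)/(_ neg)//|nw].
  by nra.
- rewrite em => pos neg; case: (Rlt_dec (ev h (p v)) 0) => [/(os S ST i v iS vS' pos)//|nv].
  case: (Rlt_dec (ev h (p w)) 0) => [/(os S ST i w iS wS' pos)//|nw].
  by nra.
- exact: (os S ST i j).
Qed.

Definition crosses h p T i j :=
  (exists2 S, S \in T & (i \in S) && (j \in S)) /\ 0 < ev h (p i) /\ ev h (p j) < 0.

(** Since [h] vanishes at the new vertex, no crossing edge is created, and the edge from [v] to [w]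
    is gone. *)
Lemma crosses_split h i j : ev h m = 0 -> crosses h p' T' i j ->
  crosses h p T i j /\ (i, j) != (v, w).
Proof.
move=> m0 [[S' S'T' /andP[iS' jS']]]; have [S [ST H]] := split_vertex S'T'.
rewrite /p'; case: (H i iS') => [[-> _ _]|[/negbTE-> iS]]; first by rewrite eqxx; lra.
case: (H j jS') => [[-> _ _]|[/negbTE-> jS]]; first by rewrite eqxx; lra.
move=> s; split; first by split=> //; exists S => //; rewrite iS.
by apply/eqP => -[iv jw]; have := split_edge S'T'; rewrite -iv -jw iS' jS'.
Qed.

End EdgeSplit.

Definition subdivided K (hs : list (affine n)) := exists N p T,
  [/\ complex N p T, covers N p T K &
      forall h, In h hs -> forall S, S \in T -> one_sided h p S].

(** Induction on a list containing all edges crossed by the zero set of [h]: each cut removes one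
    entry, adds none, and keeps the earlier forms one-sided. *)
Lemma subdivide_one K hs h : subdivided K hs -> subdivided K (h :: hs).
Proof.
move=> [N [p [T [cT cov os]]]].
have [L HL] : exists L : seq (nat * nat), forall i j, crosses h p T i j -> (i, j) \in L.
  exists [seq (i, j) | i <- iota 0 N, j <- iota 0 N] => i j [[S ST /andP[iS jS]] _].
  by apply/allpairsP; exists (i, j); rewrite !mem_iota !(complex_lt cT ST).
elim: L N p T cT cov os HL => [|[v w] L IH] N p T cT cov os HL.
  exists N, p, T; split=> // h' [<-|/os//] S ST i j iS jS pos neg.
  by have := HL i j; rewrite in_nil => /(_ (conj (ex_intro2 _ _ S ST (introT andP (conj iS jS)))
      (conj pos neg))).
case: (classic (crosses h p T v w)) => [cr|ncr]; last first.
  apply: (IH N p T) => // i j cr; have := HL i j cr; rewrite inE => /orP[/eqP[e1 e2]|//].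
  by case: ncr; rewrite -e1 -e2.
have [[S ST /andP[vS wS]] [pos neg]] := cr.
have vN := complex_lt cT ST vS; have wN := complex_lt cT ST wS.
have vw : v != w by apply/eqP => e; rewrite e in pos; lra.
(* The zero of [h] on the edge is the point with weight [t] on [w]. *)
pose t := ev h (p v) / (ev h (p v) - ev h (p w)).
have t01 : 0 < t < 1.
  split; first by apply: Rdiv_lt_0_compat; lra.
  suff : 0 < - ev h (p w) / (ev h (p v) - ev h (p w)).
    have -> : - ev h (p w) / (ev h (p v) - ev h (p w)) = 1 - t by rewrite /t; field; lra.
    by lra.
  by apply: Rdiv_lt_0_compat; lra.
have m0 : ev h (vadd (vscale (1 - t) (p v)) (vscale t (p w))) = 0.
  have -> : ev h (vadd (vscale (1 - t) (p v)) (vscale t (p w))) = (1 - t) * ev h (p v) + t * ev h (p w).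
    by rewrite /ev dotDr !dotZr; ring.
  by rewrite /t; field; lra.
apply: IH (complex_split cT vw vN wN t01) (covers_split cT vw vN wN t01 cov) _ _.
- by move=> h' /os H; apply: one_sided_split.
- move=> i j /(crosses_split cT vN wN m0)[/HL]; rewrite inE => /orP[/eqP->|//].
  by rewrite eqxx.
Qed.

End Complexes.

Lemma rsum_recl k (F : nat -> R) : \rsum_(i < k.+1) F i = F 0%N + \rsum_(i < k) F i.+1.
Proof. by rewrite big_ord_recl. Qed.

Lemma rsum_subseq N (s : seq nat) (F : nat -> R) :
  uniq s -> (forall i, i \in s -> (i < N)%N) -> (forall i, i \notin s -> F i = 0) ->
  \rsum_(i < N) F i = \rsum_(j < size s) F (nth 0%N s j).
Proof.
move=> us lt F0.
rewrite -(big_mkord xpredT F) (bigID (mem s)) /= [X in _ + X]big1 => [|i /F0 //].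
rewrite Rplus_0_r /index_iota subn0 -(big_mkord xpredT (fun j => F (nth 0%N s j))) -(big_nth 0%N
    xpredT F).
rewrite -big_filter; apply: perm_big; apply: uniq_perm => //.
  by rewrite filter_uniq // iota_uniq.
move=> i; rewrite mem_filter mem_iota /= add0n.
by case: (boolP (i \in s)) => // /lt ->.
Qed.

(** * From adapted complexes to triangulations of the cube *)

Section Triangulations.
Context (n : nat).
Implicit Types (x y z : vec n) (h : affine n) (K : vec n -> Prop).
Implicit Types (p : nat -> vec n) (S : seq nat) (T : seq (seq nat)) (N : nat).

Lemma subdivided_cube K : closed_cube K -> subdivided K [::].
Proof.
(* The corner simplex at [c] with legs of length [M] contains the cube: each of the [n] quotients
   [(y k - c k) / M] is at most [/ INR n] there. *)
move=> [c [s [s0 cubeE]]]; pose M := INR n * s.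
have M0 (i : 'I_n) : 0 < M.
  apply: Rmult_lt_0_compat => //; apply: lt_0_INR; apply/ltP.
  exact: leq_ltn_trans (leq0n _) (ltn_ord i).
pose p (i : nat) : vec n := fun k => c k + (if i == k.+1 then M else 0).
have pE (a : nat -> R) (k : 'I_n) : \rsum_(i < n.+1) a i = 1 -> realize n.+1 p a k = c k + a k.+1 * M.
  move=> a1; rewrite /realize /p.
  have -> : \rsum_(i < n.+1) (a i * (c k + (if i == k.+1 :> nat then M else 0))) =
    \rsum_(i < n.+1) (c k * a i) + \rsum_(i < n.+1) ((if i == k.+1 :> nat then M else 0) * a i).
    by rewrite -rsumD; apply: eq_bigr => i _; ring.
  by rewrite -rsumZ a1 rsum_delta ?ltnS //; ring.
exists n.+1, p, [:: iota 0 n.+1]; split=> //.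
  split=> [S i|S S' a b].
    by rewrite inE => /eqP->; rewrite mem_iota.
  rewrite !inE => /eqP-> /eqP-> [a0 [sa a1]] [b0 [sb b1]] e.
  have eS (k : 'I_n) : a k.+1 = b k.+1.
    have := pE a k a1; rewrite e pE // => e'.
    by apply: (Rmult_eq_reg_r M); have := M0 k; lra.
  have e0 : a 0%N = b 0%N.
    move: a1 b1; rewrite !rsum_recl.
    have -> : \rsum_(i < n) a i.+1 = \rsum_(i < n) b i.+1 by apply: eq_bigr => k _; apply: eS.
    by slra.
  move=> [//|i]; have [lt|ge] := ltnP i n; first by rewrite (eS (Ordinal lt)).
  by rewrite sa ?sb // mem_iota /= add0n ltnS -leqNgt.
move=> y /cubeE yK.
(* The weight of vertex [j.+1], with default 0 beyond the dimension; vertex 0, placed at the corner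
   [c], gets the remaining weight. *)
pose F (j : nat) := if insub j is Some k then (y k - c k) / M else 0.
have FE (k : 'I_n) : F k = (y k - c k) / M by rewrite /F valK.
have F0 j : 0 <= F j.
  rewrite /F; case: insubP => [k _ _|_]; last exact: Rle_refl.
  by apply: Rle_mult_inv_pos (M0 k); have := yK k; slra.
have F1 : \rsum_(j < n) F j <= 1.
  have [n0|n0] := posnP n.
    rewrite rsum_eq0; first by lra.
    by move=> [i lti]; exfalso; have := lti; rewrite [X in (_ < X)%N]n0.
  have nr : 0 < INR n by apply: lt_0_INR; apply/ltP.
  have -> : 1 = \rsum_(j < n) / INR n by rewrite rsum_const; field; lra.
  apply: rsum_le => k; rewrite FE; have := M0 k => Mk.
  have -> : / INR n = s / M by rewrite /M; field; lra.
  by apply: Rmult_le_compat_r; [apply/Rlt_le/Rinv_0_lt_compat | have := yK k; slra].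
pose a (i : nat) := if i is j.+1 then F j else 1 - \rsum_(j < n) F j.
have a1 : \rsum_(i < n.+1) a i = 1.
  by rewrite rsum_recl /a; slra.
exists (iota 0 n.+1), a; split; first by rewrite inE.
  split; [|split=> //].
    by move=> [|i] /=; [slra | apply: F0].
  move=> [|i]; rewrite mem_iota //= add0n ltnS => ge.
  by rewrite /F insubN.
apply: vec_ext => k; rewrite pE //= FE.
by have := M0 k; intros; field; lra.
Qed.

Lemma subdivided_list K hs : closed_cube K -> subdivided K hs.
Proof.
by move=> cK; elim: hs => [|h hs IH]; [apply: subdivided_cube | apply: subdivide_one].
Qed.

Lemma cube_polyhedron K : closed_cube K -> exists l, forall y, K y <-> polyhedron l y.
Proof.
move=> [c [s [s0 cubeE]]].
pose e (i : 'I_n) : vec n := fun k => if k == i then 1 else 0.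
have ee i y : dot (e i) y = y i by rewrite /dot /e rsum_deltaI Rmult_1_l.
exists (List.map (fun i => (e i, - c i)) (enum 'I_n) ++
        List.map (fun i => (vscale (-1) (e i), c i + s)) (enum 'I_n))%list => y.
rewrite cubeE; split.
  move=> H h /in_app_iff[] /in_map_iff[i [<- _]]; rewrite /ev /= ?dotZl ee;
  by have := H i; lra.
move=> H i; have In_enum : In i (enum 'I_n) by apply/In_mem; rewrite mem_enum.
have := H (e i, - c i); have := H (vscale (-1) (e i), c i + s).
rewrite /ev /= dotZl ee => H1 H2.
have /H1 : In (vscale (-1) (e i), c i + s) (List.map (fun i => (e i, - c i)) (enum 'I_n) ++
        List.map (fun i => (vscale (-1) (e i), c i + s)) (enum 'I_n))%list.
  by apply/in_app_iff; right; apply/in_map_iff; exists i.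
have /H2 : In (e i, - c i) (List.map (fun i => (e i, - c i)) (enum 'I_n) ++
        List.map (fun i => (vscale (-1) (e i), c i + s)) (enum 'I_n))%list.
  by apply/in_app_iff; left; apply/in_map_iff; exists i.
by lra.
Qed.

Lemma nth_map_vec p S j : (j < size S)%N -> nth (@vzero n) (map p S) j = p (nth 0%N S j).
Proof. by move=> lt; rewrite (nth_map 0%N). Qed.

(** Translates weights indexed by position in the list into weights indexed by vertex number. *)
Lemma conv_realize N p S y : uniq S -> (forall i, i \in S -> (i < N)%N) ->
  conv (map p S) y <-> exists2 a, weight N S a & realize N p a = y.
Proof.
move=> us lt; split.
  move=> [w [w0 [w1 wE]]]; pose a i := if i \in S then w (index i S) else 0.
  have sa : supported S a by move=> i /negbTE ni; rewrite /a ni.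
  have aE j : (j < size S)%N -> a (nth 0%N S j) = w j.
    by move=> jS; rewrite /a mem_nth // index_uniq.
  rewrite size_map in w0 w1 wE; exists a.
    split; [|split=> //].
      by move=> i; rewrite /a; case: ifP => iS; [apply: w0; rewrite index_mem | lra].
    by rewrite (rsum_subseq us lt sa) -w1; apply: eq_bigr => j _; rewrite aE.
  apply: vec_ext => c; rewrite /realize wE (rsum_subseq (F := fun i => a i * p i c) us lt).
    by apply: eq_bigr => j _; rewrite aE // nth_map_vec.
  by move=> i /sa ->; ring.
move=> [a [a0 [sa a1]] <-]; exists (fun j => a (nth 0%N S j)); rewrite size_map.
split=> [j _|]; first exact: a0.
split=> [|c]; first by rewrite -(rsum_subseq us lt sa).
rewrite /realize (rsum_subseq (F := fun i => a i * p i c) us lt) => [|i /sa ->]; last by ring.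
by apply: eq_bigr => j _; rewrite nth_map_vec.
Qed.

Lemma subset_weight N S S' a : {subset S' <= S} -> weight N S' a -> weight N S a.
Proof.
by move=> sub [a0 [sa a1]]; split=> //; split=> // i ni; apply: sa; apply: contra ni => /sub.
Qed.

Definition barycenter S i := if i \in S then / INR (size S) else 0.

Lemma barycenter_weight N S : uniq S -> (forall i, i \in S -> (i < N)%N) -> (0 < size S)%N ->
  weight N S (barycenter S).
Proof.
move=> us lt S0; have pos : 0 < INR (size S) by apply: lt_0_INR; apply/ltP.
have sb : supported S (barycenter S) by move=> i /negbTE ni; rewrite /barycenter ni.
split; [|split=> //].
  by move=> i; rewrite /barycenter; case: ifP => _; [apply/Rlt_le/Rinv_0_lt_compat | lra].
rewrite (rsum_subseq us lt sb).
have -> : \rsum_(j < size S) barycenter S (nth 0%N S j) = \rsum_(j < size S) / INR (size S).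
  by apply: eq_bigr => j _; rewrite /barycenter mem_nth.
by rewrite rsum_const; field; lra.
Qed.

(* Perturbing the barycenter by an affine dependence would give two sets of barycentric coordinates
   for one point. *)
Lemma complex_aff_indep N p T S S0 : complex N p T -> S0 \in T -> {subset S <= S0} ->
  uniq S -> aff_indep (map p S).
Proof.
move=> cT S0T sub us c; rewrite size_map => c0 cE j jS.
have lt i : i \in S -> (i < N)%N by move=> /sub; apply: complex_lt cT S0T.
have S0' : (0 < size S)%N by apply: leq_ltn_trans jS.
have pos : 0 < INR (size S) by apply: lt_0_INR; apply/ltP.
(* [eps] is such that no [eps * Rabs (c k)] exceeds the common weight [/ INR (size S)] of the
   barycenter. *)
pose A := \rsum_(k < size S) Rabs (c k); pose eps := / (INR (size S) * (A + 1)).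
have A0 : 0 <= A by apply: rsum_ge0 => k; apply: Rabs_pos.
have e0 : 0 < eps by apply: Rinv_0_lt_compat; apply: Rmult_lt_0_compat; lra.
pose d i := if i \in S then c (index i S) else 0.
have dE k : (k < size S)%N -> d (nth 0%N S k) = c k.
  by move=> kS; rewrite /d mem_nth // index_uniq.
have sd : supported S d by move=> i /negbTE ni; rewrite /d ni.
have wb := barycenter_weight us lt S0'.
have wbd : weight N S (fun i => barycenter S i + eps * d i).
  case: wb => b0 [sb b1]; split; [|split].
  - move=> i; rewrite /barycenter /d; case: ifP => iS; last by lra.
    have kS : (index i S < size S)%N by rewrite index_mem.
    have := rsum_ge_term (F := fun k : 'I_(size S) => Rabs (c k)) (Ordinal kS) (fun k => Rabs_pos _).
    rewrite -/A /= => le.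
    have -> : / INR (size S) = eps * (A + 1) by rewrite /eps; field; lra.
    have := Rle_abs (- c (index i S)); rewrite Rabs_Ropp => le'.
    by rewrite -Rmult_plus_distr_l; apply: Rmult_le_pos; lra.
  - by move=> i ni; rewrite sb // sd //; ring.
  - by rewrite rsumD b1 -rsumZ (rsum_subseq us lt sd) (eq_bigr (fun k : 'I_(size S) => c k)) ?c0 =>
      [|k _]; [ring | rewrite dE].
have := cT.2 S0 S0 _ _ S0T S0T (subset_weight sub wbd) (subset_weight sub wb) _ (nth 0%N S j).
rewrite dE //.
have -> : realize N p (fun i => barycenter S i + eps * d i) = realize N p (barycenter S).
  apply: vec_ext => k; rewrite /realize.
  have -> : \rsum_(i < N) ((barycenter S i + eps * d i) * p i k) =
     \rsum_(i < N) (barycenter S i * p i k) + eps * \rsum_(i < N) (d i * p i k).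
    by rewrite rsumZ -rsumD; apply: eq_bigr => i _; ring.
  rewrite (rsum_subseq (F := fun i => d i * p i k) us lt) => [|i /sd ->]; last by ring.
  rewrite (eq_bigr (fun j : 'I_(size S) => c j * nth (@vzero n) (map p S) j k)) => [|i _].
    by rewrite cE; ring.
  by rewrite dE // nth_map_vec.
by move=> /(_ erefl) e; apply: (Rmult_eq_reg_l eps); lra.
Qed.

Lemma subseqs_ex (S : seq nat) : exists L : seq (seq nat), forall F, F \in L <-> subseq F S.
Proof.
elim: S => [|i S [L HL]]; first by exists [:: [::]] => F; rewrite inE subseq0.
exists (map (cons i) L ++ L) => F; rewrite mem_cat; split.
  case/orP => [/mapP[F' /HL sF' ->]|/HL sF]; first by rewrite /= eqxx.
  by apply: subseq_trans sF _; apply: subseq_cons.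
case: F => [|j F]; first by move=> _; apply/orP; right; apply/HL; apply: sub0seq.
rewrite /=; case: eqP => [->|_] sF; apply/orP; [left|right; exact/HL].
by apply/mapP; exists F => //; apply/HL.
Qed.

(** In a complex for which all forms defining the cube and the cells are one-sided, the nonempty
    faces with all vertices in the cube triangulate it, and each of them lies in a single cell. *)
Lemma cellwise_piecewise_linear K (g : vec n -> R) :
  closed_cube K -> cellwise_affine K g -> piecewise_linear K g.
Proof.
move=> cK pg; have := pg => -[cs [cov aff]]; have [lK KE] := cube_polyhedron cK.
have [N [p [T [cT cv os]]]] :=
  subdivided_list (lK ++ List.flat_map fst cs)%list cK.
have osK h S : In h lK -> S \in T -> one_sided h p S.
  by move=> hl; apply: os; apply/in_app_iff; left.
have osc h c S : In c cs -> In h c.1 -> S \in T -> one_sided h p S.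
  by move=> cin hc; apply: os; apply/in_app_iff; right; apply/in_flat_map; exists c.
have [L HL] : exists L : list (seq nat), forall F, In F L <->
    exists S, [/\ S \in T, subseq F (undup S) & (0 < size F)%N /\ forall i, i \in F -> K (p i)].
  have [cs0 [H1 H2]] := list_map_ex (l := T) (P := fun S L => forall F, F \in L <-> subseq F (undup S))
    (fun S _ => subseqs_ex (undup S)).
  have [L HL] := list_filter_ex (fun F => (0 < size F)%N /\ forall i, i \in F -> K (p i))
      (List.concat cs0).
  exists L => F; rewrite HL; split.
    move=> [/in_concat[L' [L'in FL'] HF]]; have [S [ST HS]] := H2 L' L'in.
    by exists S; split=> //; [apply/In_mem | apply/HS/In_mem].
  move=> [S [/In_mem ST sF HF]]; split=> //.
  have [L' [L'in HS]] := H1 S ST; apply/in_concat; exists L'; split=> //.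
  by apply/In_mem/HS.
have LP F : In F L -> exists S, [/\ S \in T, {subset F <= S}, uniq F & forall i, i \in F -> (i < N)%N].
  move=> /HL[S [ST sF _]]; exists S.
  have sub : {subset F <= S} by move=> i /(mem_subseq sF); rewrite mem_undup.
  split=> //; first by apply: subseq_uniq sF (undup_uniq _).
  by move=> i /sub; apply: complex_lt cT ST.
have convK F y : In F L -> conv (map p F) y -> K y.
  move=> FL; have [S [ST sub us lt]] := LP F FL; have [_ [_ _ [_ FK]]] := (HL F).1 FL.
  move=> /(conv_realize p y us lt)[a wa <-]; apply/KE => h hl.
  by apply: ev_realize_ge0 wa _ => i /FK/KE; apply.
exists (List.map (map p) L); split; last split; last first.
- move=> _ /in_map_iff[F [<- FL]].
  have [S [ST sub us lt]] := LP F FL; have [_ [_ _ [F0 FK]]] := (HL F).1 FL.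
  have wb := barycenter_weight us lt F0.
  have bK : K (realize N p (barycenter F)).
    by apply: (convK F) => //; apply/(conv_realize p _ us lt); exists (barycenter F).
  (* The barycenter has positive weight at every vertex, so by one-sidedness the forms of a cell
     containing it are nonnegative at all vertices, hence on the whole face. *)
  have [c [cin cb]] := cov _ bK; exists c.2.1, c.2.2 => y cy.
  rewrite (aff y c) //; first exact: convK FL cy.
  move: cy => /(conv_realize p y us lt)[a wa <-] h hc.
  apply: ev_realize_ge0 wa _ => i iF.
  apply: one_sided_vertex (subset_weight sub wb) (osc h c S cin hc ST) (cb h hc) (lt i iF) _.
  by rewrite /barycenter iF; apply: Rinv_0_lt_compat; apply: lt_0_INR; apply/ltP.
- exact: cellwise_continuous.
split=> [_ /in_map_iff[F [<- FL]]|].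
  have [S [ST sub us lt]] := LP F FL; have [_ [_ _ [F0 FK]]] := (HL F).1 FL.
  by rewrite size_map; split=> //; apply: complex_aff_indep cT ST sub us.
split=> [y|_ _ /in_map_iff[F1 [<- F1L]] /in_map_iff[F2 [<- F2L]]].
  split=> [Ky|[_ [/in_map_iff[F [<- FL]]]]]; last exact: convK.
  have [S [a [ST wa ra]]] := cv y Ky.
  (* The simplex containing [y] may stick out of the cube. Its face on the vertices of positive
     weight does not, by one-sidedness for the forms of the cube. *)
  pose F := filter (fun i => Rlt_dec 0 (a i)) (undup S).
  have uF : uniq F by rewrite filter_uniq // undup_uniq.
  have FP i : i \in F -> 0 < a i /\ i \in S.
    by rewrite mem_filter mem_undup => /andP[]; case: Rlt_dec.
  have lt i : i \in F -> (i < N)%N by move=> /FP[_]; apply: complex_lt cT ST.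
  have wF : weight N F a.
    case: wa => a0 [sa a1]; split=> //; split=> // i.
    rewrite mem_filter mem_undup negb_and => /orP[|/sa//].
    by case: Rlt_dec => // ? _; have := a0 i; slra.
  exists (map p F); split; last by apply/(conv_realize p y uF lt); exists a.
  apply/in_map_iff; exists F; split=> //; apply/HL; exists S; split=> //.
    exact: filter_subseq.
  split.
    case: (F) wF => // -[_ [s0]]; rewrite rsum_eq0 => [|i]; first by lra.
    exact: s0.
  move=> i iF; apply/KE => h hl; have [ai iS] := FP i iF.
  apply: one_sided_vertex wa (osK h S hl ST) _ (lt i iF) ai.
  by rewrite ra; move/KE: Ky; apply.
have [S1 [S1T sub1 us1 lt1]] := LP F1 F1L; have [S2 [S2T sub2 us2 lt2]] := LP F2 F2L.
(* By uniqueness of coordinates, a point of both faces has weight only on their common vertices. *)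
exists (map p [seq i <- F1 | i \in F2]).
have uF : uniq [seq i <- F1 | i \in F2] by rewrite filter_uniq.
have lt i : i \in [seq i <- F1 | i \in F2] -> (i < N)%N.
  by rewrite mem_filter => /andP[_ /lt1].
split=> [v|y].
  move=> /in_map_iff[i [<- /In_mem]]; rewrite mem_filter => /andP[i2 i1].
  by split; apply/in_map_iff; exists i; split=> //; apply/In_mem.
split.
  move=> [/(conv_realize p y us1 lt1)[a wa ra] /(conv_realize p y us2 lt2)[b wb rb]].
  apply/(conv_realize p y uF lt); exists a => //.
  have ab := cT.2 S1 S2 a b S1T S2T (subset_weight sub1 wa) (subset_weight sub2 wb).
  rewrite ra rb in ab; have {}ab := ab erefl.
  case: wa => a0 [sa a1]; split=> //; split=> // i.
  rewrite mem_filter negb_and => /orP[i2|/sa//].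
  by rewrite ab; apply: wb.2.1.
move=> /(conv_realize p y uF lt)[a wa ra].
split; [apply/(conv_realize p y us1 lt1)|apply/(conv_realize p y us2 lt2)]; exists a => //;
  by apply: subset_weight wa => i; rewrite mem_filter => /andP[].
Qed.

End Triangulations.

(** * Finite subcovers *)

Lemma list_bound (T : Type) (F : T -> R) (l : list T) :
  exists B, 0 <= B /\ forall x, In x l -> F x <= B.
Proof.
elim: l => [|a l [B [B0 H]]]; first by exists 0; split=> //; lra.
exists (Rmax B (F a)); have := Rmax_l B (F a); have := Rmax_r B (F a) => mr ml.
by split=> [|x [<-|/H]]; slra.
Qed.

(** The cover is indexed by centre, radius and witness together, so that the finite subcover carries
    its local witnesses along. *)
Lemma compact_finite_balls n (X : vec n -> Prop) (T : Type) (P : vec n -> R -> T -> Prop) :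
  compact_set X -> (forall x, X x -> exists r t, 0 < r /\ P x r t) ->
  exists l : list (vec n * R * T), forall x, X x -> exists q,
    [/\ In q l, P q.1.1 q.1.2 q.2 & norm1 (vsub x q.1.1) < q.1.2].
Proof.
move=> cX loc.
have [||l H] := cX (vec n * R * T)%type
    (fun q y => P q.1.1 q.1.2 q.2 /\ norm1 (vsub y q.1.1) < q.1.2).
- move=> [[x r] t] y [Pq /= lt].
  have n0 : 0 < INR n + 1 by have := pos_INR n; lra.
  (* The factor [INR n + 1] converts Euclidean distance into [norm1] and is positive in dimension 0
     too. *)
  exists ((r - norm1 (vsub y x)) / (INR n + 1)); split.
    by apply: Rdiv_lt_0_compat => //; lra.
  move=> z zy; split=> //=; have := norm1_triangle z y x; have := norm1_le_norm (vsub z y).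
  have := norm_ge0 (vsub z y); move: zy; set a := norm (vsub z y).
  set b := _ / _ => ab; have -> : r = norm1 (vsub y x) + (INR n + 1) * b by rewrite /b; field; lra.
  by have := pos_INR n; snra.
- move=> x /loc[r [t [r0 Pq]]]; exists ((x, r), t); split=> //=.
  by rewrite /norm1 rsum_eq0 // => i; rewrite /vsub Rminus_diag Rabs_R0.
by exists l => x /H[q [ql [Pq lt]]]; exists q.
Qed.

(** * Ideals of R(X) *)

Section RieszSpace.
Context (n : nat) (X K : vec n -> Prop).
Hypotheses (cX : compact_set X) (cK : closed_cube K) (XK : forall x, X x -> K x).
Implicit Types (f g h : pt X -> R) (p : pt X) (I J : (pt X -> R) -> Prop).

Lemma RX_cellwise f : RX K f <-> exists2 g, cellwise_affine K g & forall p, f p = g (proj1_sig p).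
Proof.
split=> [[g [/piecewise_linear_cellwise plg fg]]|[g cg fg]]; exists g => //.
by split=> //; apply: cellwise_piecewise_linear.
Qed.

Lemma RX_add f g : RX K f -> RX K g -> RX K (fun p => f p + g p).
Proof.
move=> /RX_cellwise[F cF Fe] /RX_cellwise[G cG Ge]; apply/RX_cellwise.
by exists (fun y => F y + G y) => [|p]; [apply: cellwise_add | rewrite Fe Ge].
Qed.

Lemma RX_scale a f : RX K f -> RX K (fun p => a * f p).
Proof.
move=> /RX_cellwise[F cF Fe]; apply/RX_cellwise.
by exists (fun y => a * F y) => [|p]; [apply: cellwise_scale | rewrite Fe].
Qed.

Lemma RX_abs f : RX K f -> RX K (fun p => Rabs (f p)).
Proof.
move=> /RX_cellwise[F cF Fe]; apply/RX_cellwise.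
by exists (fun y => Rabs (F y)) => [|p]; [apply: cellwise_abs | rewrite Fe].
Qed.

Lemma RX_const c : RX (X := X) K (fun _ => c).
Proof. by apply/RX_cellwise; exists (fun _ => c) => //; apply: cellwise_const. Qed.

Lemma RX_continuous f p eps : RX K f -> 0 < eps ->
  exists r, 0 < r /\
    forall q : pt X, norm1 (vsub (proj1_sig q) (proj1_sig p)) < r -> Rabs (f q - f p) < eps.
Proof.
move=> /RX_cellwise[F /cellwise_continuous cF Fe] e0.
have [r [r0 H]] := cF (proj1_sig p) (XK (proj2_sig p)) eps e0.
exists r; split=> // q lt; rewrite !Fe; apply: H; first exact: XK (proj2_sig q).
by have := norm_le_norm1 (vsub (proj1_sig q) (proj1_sig p)); lra.
Qed.

Lemma RX_bounded f : RX K f -> exists B, 0 <= B /\ forall p, Rabs (f p) <= B.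
Proof.
move=> fR.
have [x Xx|l H] := @compact_finite_balls n X R (fun x r b => forall q : pt X,
    norm1 (vsub (proj1_sig q) x) < r -> Rabs (f q) <= b) cX.
  have [|r [r0 H]] := @RX_continuous f (exist _ x Xx) 1 fR; first by lra.
  exists r, (Rabs (f (exist _ x Xx)) + 1); split=> // q /H lt.
  by have := Rabs_triang_inv (f q) (f (exist _ x Xx)); lra.
have [B [B0 HB]] := list_bound snd l; exists B; split=> // p.
have [q [ql Pq lt]] := H _ (proj2_sig p).
by have := Pq p lt; have := HB q ql; lra.
Qed.

Definition point_ideal p f := RX K f /\ f p = 0.

Lemma riesz_ideal_point p : riesz_ideal K (point_ideal p).
Proof.
split; first by move=> f [].
split; first by split=> //; apply: RX_const.
split; first by move=> f h [fR f0] [hR h0]; split; [apply: RX_add | rewrite f0 h0; ring].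
split; first by move=> a f [fR f0]; split; [apply: RX_scale | rewrite f0; ring].
move=> f h [fR f0] hR le; split=> //; have := le p; rewrite f0 Rabs_R0.
by move: (h p) => c; rewrite /Rabs; case: Rcase_abs; slra.
Qed.

(** By compactness [f] is bounded, hence dominated by a multiple of [F]. *)
Lemma ideal_of_unit I F : riesz_ideal K I -> I F -> (forall p, 1 <= F p) ->
  forall f, RX K f -> I f.
Proof.
move=> [_ [_ [_ [sc sol]]]] IF F1 f fR; have [B [B0 HB]] := RX_bounded fR.
apply: (sol (fun p => B * F p)) => // [|p]; first exact: sc.
rewrite (Rabs_pos_eq (B * F p)); first by have := HB p; have := F1 p; snra.
by have := F1 p; snra.
Qed.

Lemma maximal_point_ideal p : maximal_ideal K (point_ideal p).
Proof.
split; first exact: riesz_ideal_point.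
split; first by exists (fun _ => 1); split=> [|[_]]; [apply: RX_const | lra].
move=> J J_ideal [h [hR nJh]] sub f Jf.
have [JR [_ [add [sc _]]]] := J_ideal.
split; first exact: JR.
apply: NNPP => fp; apply: nJh; apply: (ideal_of_unit (F := fun _ => 1) J_ideal) => // [|_]; last by lra.
(* If [f p] is nonzero, [f p - f] vanishes at [p] and so lies in [J]; adding [f] and dividing by
   [f p] puts the constant 1 into [J]. *)
have : J (fun q => / f p * (f q + (f p + -1 * f q))).
  apply: sc; apply: (add f) => //; apply: sub; split; last by ring.
  apply: (@RX_add (fun _ => f p)); [exact: RX_const | exact/RX_scale/JR].
have -> // : (fun q => / f p * (f q + (f p + -1 * f q))) = (fun _ => 1).
by apply: functional_extensionality => q; field.
Qed.

(* By compactness, an ideal without common zero contains a finite sum of absolute values bounded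
   below by 1. *)
Lemma ideal_common_zero I : riesz_ideal K I -> (exists f, RX K f /\ ~ I f) ->
  exists p, forall f, I f -> f p = 0.
Proof.
move=> I_ideal [h [hR nIh]]; apply: NNPP => no; apply: nIh.
have [IR [I0 [add [sc sol]]]] := I_ideal.
have ex p : exists f, I f /\ f p <> 0.
  apply: NNPP => nf; apply: no; exists p => f If; apply: NNPP => fp.
  by apply: nf; exists f.
have [x Xx|l H] := @compact_finite_balls n X (pt X -> R) (fun x r f => I f /\ forall q : pt X,
    norm1 (vsub (proj1_sig q) x) < r -> 1 <= Rabs (f q)) cX.
  have [f [If fp]] := ex (exist _ x Xx); set p := exist _ x Xx in fp.
  (* With value 2 at [p], the function stays above 1 nearby. *)
  have If2 : I (fun q => 2 / f p * f q) by apply: sc.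
  have [|r [r0 H]] := @RX_continuous _ p 1 (IR _ If2); first by lra.
  exists r, (fun q => 2 / f p * f q); split=> //; split=> // q /H.
  have -> : 2 / f p * f p = 2 by field.
  by rewrite /Rabs; case: Rcase_abs; case: Rcase_abs; slra.
have [F [IF F0 FP]] : exists F, [/\ I F, forall p, 0 <= F p & forall q, In q l -> I q.2 ->
    forall p, Rabs (q.2 p) <= F p].
  elim: (l) => [|a s [F [IF F0 FP]]]; first by exists (fun _ => 0); split=> // _; lra.
  case: (classic (I a.2)) => Ia; last first.
    by exists F; split=> // q [<-|/FP].
  exists (fun p => Rabs (a.2 p) + F p); split.
  - apply: add => //; apply: (sol a.2) => //; first by apply: RX_abs; apply: IR.
    by move=> p; rewrite Rabs_Rabsolu; lra.
  - by move=> p; have := Rabs_pos (a.2 p); have := F0 p; lra.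
  - move=> q [<-|ql] Iq p; first by have := F0 p; lra.
    by have := FP q ql Iq p; have := Rabs_pos (a.2 p); lra.
apply: (ideal_of_unit I_ideal IF) hR => p.
have [q [ql [Iq Pq] lt]] := H _ (proj2_sig p).
by have := Pq p lt; have := FP q ql Iq p; lra.
Qed.

Lemma not_strongly_semisimpleP : ~ strongly_semisimple X K <->
  exists f g : vec n -> R, [/\ cellwise_affine K f, cellwise_affine K g,
    forall y, 0 <= f y /\ 0 <= g y,
    forall y, X y -> g y = 0 -> f y = 0 &
    forall m, exists y, X y /\ INR m * g y < f y].
Proof.
split.
  move=> nss; apply: NNPP => no; apply: nss => g gR.
  (* The family of point ideals at the zeros of [g]. A function in all of them but not in the
     principal ideal provides, with [g], the pair that was assumed not to exist. *)
  exists (fun M => exists p, g p = 0 /\ M = point_ideal p); split.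
    by move=> _ [p [_ ->]]; apply: maximal_point_ideal.
  move=> f; split.
    move=> [fR [m le]]; split=> // _ [p [gp ->]]; split=> //.
    have := le p; rewrite gp Rabs_R0 Rmult_0_r.
    by move: (f p) => c; rewrite /Rabs; case: Rcase_abs; slra.
  move=> [fR H]; split=> //; apply: NNPP => nle; apply: no.
  have [G cG Ge] := (RX_cellwise g).1 gR; have [F cF Fe] := (RX_cellwise f).1 fR.
  exists (fun y => Rabs (F y)), (fun y => Rabs (G y)); split.
  - exact: cellwise_abs.
  - exact: cellwise_abs.
  - by move=> y; split; apply: Rabs_pos.
  - move=> y Xy Gy.
    have gp : g (exist _ y Xy) = 0.
      by rewrite Ge /=; apply: NNPP => /Rabs_no_R0.
    have [_] := H _ (ex_intro _ _ (conj gp erefl)); rewrite Fe /= => ->.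
    exact: Rabs_R0.
  - move=> m; apply: NNPP => nlt; apply: nle; exists m => p.
    rewrite Fe Ge; apply: Rnot_lt_le => lt; apply: nlt.
    by exists (proj1_sig p); split=> //; apply: proj2_sig.
move=> [f [g [cf cg fg0 z unb]]] ss.
have gR : RX K (fun p : pt X => g (proj1_sig p)) by apply/RX_cellwise; exists g.
have fR : RX K (fun p : pt X => f (proj1_sig p)) by apply/RX_cellwise; exists f.
have [F [Fmax FP]] := ss _ gR.
have [_ [m le]] : principal_ideal K (fun p : pt X => g (proj1_sig p)) (fun p => f (proj1_sig p)).
  (* A member [M] of the family contains [g] and is, by maximality, the point ideal of its common
     zero [p]. Then [g] vanishes at [p], hence so does [f]. *)
  apply/FP; split=> // M FM; have [M_ideal [Mproper Mmax]] := Fmax M FM.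
  have [p Hp] := ideal_common_zero M_ideal Mproper.
  have gM : M (fun p : pt X => g (proj1_sig p)).
    apply: ((FP _).1 _).2 FM; split=> //; exists 1%N => q.
    by rewrite /= Rmult_1_l; apply: Rle_refl.
  have [pM1 [pM2 _]] := maximal_point_ideal p.
  apply: (Mmax (point_ideal p)) => // [h Mh|].
    by split; [apply: M_ideal.1 | apply: Hp].
  by split=> //; apply: z (proj2_sig p) (Hp _ gM).
have [y [Xy lt]] := unb m; have := le (exist _ y Xy) => /=.
have [f0 g0] := fg0 y; rewrite !Rabs_pos_eq //; lra.
Qed.

End RieszSpace.

(** * From an outgoing tangent to an unbounded ratio *)

Definition eventually (P : nat -> Prop) := exists N : nat, forall k : nat, (N <= k)%N -> P k.

Lemma eventually_and P Q : eventually P -> eventually Q -> eventually (fun k => P k /\ Q k).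
Proof.
move=> [N HN] [M HM]; exists (maxn N M) => k; rewrite geq_max => /andP[/HN ? /HM ?].
by split.
Qed.

Lemma eventually_imp (P Q : nat -> Prop) : (forall k, P k -> Q k) -> eventually P -> eventually Q.
Proof. by move=> PQ [N HN]; exists N => k /HN/PQ. Qed.

Lemma eventually_all m (P : nat -> nat -> Prop) :
  (forall j, (j < m)%N -> eventually (P j)) -> eventually (fun k => forall j, (j < m)%N -> P j k).
Proof.
elim: m => [|m IH] H; first by exists 0%N.
have := eventually_and (IH (fun j lt => H j (ltnW lt))) (H m (ltnSn m)).
apply: eventually_imp => k [Hk Hm] j; rewrite ltnS leq_eqVlt => /orP[/eqP->//|].
exact: Hk.
Qed.

Lemma Un_cvP u l :
  Un_cv u l <-> (forall eps, 0 < eps -> eventually (fun k => Rabs (u k - l) < eps)).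
Proof.
split=> H eps e0; have [N HN] := H eps e0; exists N => k.
  by move/leP => kN; apply: HN.
by move=> kN; apply: HN; apply/leP.
Qed.

Lemma Un_cv_cst c : Un_cv (fun _ => c) c.
Proof. by apply/Un_cvP => eps e0; exists 0%N => k _; rewrite Rminus_diag Rabs_R0. Qed.

Lemma Un_cv_eq (u v : nat -> R) l : (forall k, u k = v k) -> Un_cv u l -> Un_cv v l.
Proof. by move=> /functional_extensionality ->. Qed.

Lemma Un_cv_sum m (u : 'I_m -> nat -> R) (l : 'I_m -> R) : (forall i, Un_cv (u i) (l i)) ->
  Un_cv (fun k => \rsum_(i < m) u i k) (\rsum_(i < m) l i).
Proof.
move=> H; elim: m u l H => [|m IH] u l H.
  by rewrite big_ord0; apply: Un_cv_eq (Un_cv_cst 0) => k; rewrite big_ord0.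
rewrite big_ord_recr /=.
apply: Un_cv_eq (CV_plus _ _ _ _ (IH _ _ _) (H ord_max)) => [k|i]; last exact: H.
by rewrite big_ord_recr.
Qed.

Lemma Un_cv_pos u l : Un_cv u l -> 0 < l -> eventually (fun k => 0 < u k).
Proof.
move=> /Un_cvP H /H; apply: eventually_imp => k.
by rewrite /Rabs; case: Rcase_abs; slra.
Qed.

Lemma Un_cv_neg u l : Un_cv u l -> l < 0 -> eventually (fun k => u k < 0).
Proof.
move=> /Un_cvP H l0; have /H : 0 < - l by lra.
by apply: eventually_imp => k; rewrite /Rabs; case: Rcase_abs; slra.
Qed.

Lemma Un_cv_ge0 u l : Un_cv u l -> (forall k, 0 <= u k) -> 0 <= l.
Proof.
move=> cv u0; apply: Rnot_lt_le => /(Un_cv_neg cv)[N /(_ N (leqnn N))].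
by have := u0 N; lra.
Qed.

Lemma Un_cv_abs0 u : Un_cv u 0 -> Un_cv (fun k => Rabs (u k)) 0.
Proof.
move=> /Un_cvP H; apply/Un_cvP => eps /H; apply: eventually_imp => k.
by rewrite !Rminus_0_r Rabs_Rabsolu.
Qed.

(** * Convergence of vectors and orthogonal residuals *)

Section Sequences.
Context (n : nat).
Implicit Types (x y z : vec n) (xs : nat -> vec n) (us : seq (vec n)).

Lemma coord_cv_norm1 xs x : (forall i, Un_cv (fun k => xs k i) (x i)) ->
  Un_cv (fun k => norm1 (vsub (xs k) x)) 0.
Proof.
move=> H; have {1}-> : 0 = \rsum_(i < n) 0 by rewrite rsum_eq0.
apply: Un_cv_sum => i; apply: Un_cv_abs0; rewrite /vsub -(Rminus_diag (x i)).
exact: CV_minus (H i) (Un_cv_cst _).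
Qed.

Lemma seq_cvP xs x : seq_cv xs x <-> forall i, Un_cv (fun k => xs k i) (x i).
Proof.
split=> [H i|/coord_cv_norm1/Un_cvP cv].
  apply/Un_cvP => eps /H; apply: eventually_imp => k lt.
  exact: Rle_lt_trans (coord_le_norm (vsub (xs k) x) i) lt.
move=> eps /cv; apply: eventually_imp => k; rewrite Rminus_0_r.
by have := norm_le_norm1 (vsub (xs k) x); have := Rle_abs (norm1 (vsub (xs k) x)); slra.
Qed.

Lemma dot_cv xs x z : seq_cv xs x -> Un_cv (fun k => dot (xs k) z) (dot x z).
Proof.
by move=> /seq_cvP cv; apply: Un_cv_sum => i; apply: CV_mult (cv i) (Un_cv_cst _).
Qed.

Arguments dot_cv {xs x} z _ _ _.

Lemma seq_cv_norm1 xs x : seq_cv xs x -> Un_cv (fun k => norm1 (vsub (xs k) x)) 0.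
Proof. by move=> /seq_cvP; apply: coord_cv_norm1. Qed.

Lemma dot_nth us i j : orthonormal us -> (i < size us)%N -> (j < size us)%N ->
  dot (nth (@vzero n) us i) (nth (@vzero n) us j) = if i == j then 1 else 0.
Proof. by move=> on iu ju; apply: on. Qed.

Lemma projE us j z : (j <= size us)%N ->
  proj (take j us) z =
  \big[@vadd n/@vzero n]_(l < j) vscale (dot z (nth (@vzero n) us l)) (nth (@vzero n) us l).
Proof.
move=> le; rewrite /proj size_take_min (minn_idPl le).
by apply: eq_bigr => l _; rewrite nth_take.
Qed.

(** At [vsub (xs i) x], the numerator of the Frenet quotient that defines the vector of index
    [j]. *)
Definition residual us j z := vsub z (proj (take j us) z).

Lemma residualE us j z c : (j <= size us)%N -> residual us j z c =
  z c - \rsum_(l < j) (dot z (nth (@vzero n) us l) * nth (@vzero n) us l c).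
Proof. by move=> le; rewrite /residual /vsub projE // vsumE. Qed.

Lemma residualS us j z : (j < size us)%N -> residual us j.+1 z =
  vsub (residual us j z) (vscale (dot z (nth (@vzero n) us j)) (nth (@vzero n) us j)).
Proof.
move=> lt; apply: vec_ext => c.
rewrite /vsub !residualE ?(ltnW lt) // (rsumS j (fun l => dot z (nth (@vzero n) us l) * nth (@vzero
    n) us l c)).
by rewrite /vscale; ring.
Qed.

Lemma dot_residual_perp us j z v : (j <= size us)%N ->
  (forall l, (l < j)%N -> dot v (nth (@vzero n) us l) = 0) ->
  dot (residual us j z) v = dot z v.
Proof.
move=> le perp; rewrite /residual dotBl projE // (dotC _ v) (dotC _ v) dot_sumr.
rewrite rsum_eq0 ?Rminus_0_r // => l; by rewrite dotZr perp // Rmult_0_r.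
Qed.

Lemma dot_residual us j z : orthonormal us -> (j < size us)%N ->
  dot (residual us j z) (nth (@vzero n) us j) = dot z (nth (@vzero n) us j).
Proof.
move=> on lt; apply: dot_residual_perp => [|l lj]; first exact: ltnW.
by rewrite dot_nth // ?(ltn_trans lj) // gtn_eqF.
Qed.

End Sequences.

Arguments dot_cv {n xs x} z _ _ _.

(** Summation by parts: when points are reached by successive displacements [L i] and weighted by
    [S m - S m.+1], the displacement [L i] gets coefficient [S i.+1], up to a boundary term. *)
Lemma abel_summation k (S L : nat -> R) c :
  \rsum_(m < k.+1) ((S m - S m.+1) * (c + \rsum_(i < m) L i)) =
  S 0%N * c + \rsum_(i < k) (S i.+1 * L i) - S k.+1 * (c + \rsum_(i < k) L i).
Proof.
elim: k => [|k IH].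
  by rewrite (rsumS 0 (fun m => (S m - S m.+1) * (c + \rsum_(i < m) L i))) !big_ord0; ring.
rewrite (rsumS k.+1 (fun m => (S m - S m.+1) * (c + \rsum_(i < m) L i))) IH.
by rewrite (rsumS k (fun i => S i.+1 * L i)) (rsumS k L); ring.
Qed.

(** * A piecewise linear gauge for the simplex of a tangent *)

Section OutgoingTangent.
Context (n : nat) (us : seq (vec n)) (x : vec n) (lam : nat -> R) (xs : nat -> vec n).
Hypotheses (frame : frenet_frame xs x us) (cv : seq_cv xs x).
Hypothesis (lam0 : forall j, (j < size us)%N -> 0 < lam j).

Let u j := nth (@vzero n) us j.
Let k := size us.
Let z i := vsub (xs i) x.
Let rho j i := norm (residual us j (z i)).

Let on : orthonormal us. Proof. by case: frame => _ []. Qed.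

Lemma chain_ptsE m j : (j <= m)%N ->
  nth (@vzero n) (chain_pts x lam us m) j =
  vadd x (\big[@vadd n/@vzero n]_(i < j) vscale (lam i) (u i)).
Proof. by move=> jm; rewrite nth_mkseq. Qed.

(** C' lies in the flat through [x] spanned by the frame vectors before the last. *)
Lemma chain_face_dot y : conv (chain_pts x lam us k.-1) y -> dot (vsub y x) (u k.-1) = 0.
Proof.
have k0 : (k.-1 < k)%N by rewrite prednK //; case: frame.
move=> [w [w0 [w1 yE]]]; rewrite size_mkseq in w0 w1 yE.
have := ev_conv (u k.-1, - dot x (u k.-1)) w1 yE.
rewrite dotBl /ev /= (dotC (u _) y) /Rminus => ->; apply: rsum_eq0 => j.
rewrite chain_ptsE; last by rewrite -ltnS.
rewrite dotDr dot_sumr (dotC x) rsum_eq0; first by ring.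
move=> i; have ij : (i < k.-1)%N by apply: leq_trans (ltn_ord i) _; rewrite -ltnS.
by rewrite dotZr dotC /u dot_nth // ?(ltn_trans ij k0) // ltn_eqF //; ring.
Qed.

(** Coordinates in units of [lam l], shifted by one so that index 0 holds the constant 1. Within the
    flat of the frame, C is the set where these numbers decrease from 1 and stay nonnegative. *)
Definition slope j y := if j is l.+1 then dot (vsub y x) (u l) / lam l else 1.

Lemma conv_chain y : (forall c, residual us k (vsub y x) c = 0) ->
  (forall j, (j < k)%N -> slope j.+1 y <= slope j y) -> 0 <= slope k y ->
  conv (chain_pts x lam us k) y.
Proof.
(* The barycentric weights are the successive drops of the slopes; the value 0 beyond [k] makes the
   last weight equal to [slope k y]. *)
move=> res0 dec last0; pose S j := if (j <= k)%N then slope j y else 0.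
exists (fun m => S m - S m.+1); rewrite size_mkseq; split; [|split].
- move=> j; rewrite ltnS => jk; rewrite /S jk; case: ifP => lt.
    by have := dec j lt; lra.
  have -> : j = k by apply/eqP; rewrite eqn_leq jk leqNgt lt.
  by lra.
- have := abel_summation k S (fun _ => 0) 1.
  have -> : \rsum_(m < k.+1) ((S m - S m.+1) * (1 + \rsum_(i < m) 0)) =
            \rsum_(m < k.+1) (S m - S m.+1).
    by apply: eq_bigr => m _; rewrite rsum_eq0 //; ring.
  move=> ->; rewrite rsum_eq0 => [|i]; last by ring.
  by rewrite {2}/S ltnn /S /=; ring.
move=> c.
have -> : \rsum_(j < k.+1) ((S j - S j.+1) * nth (@vzero n) (chain_pts x lam us k) j c) =
   \rsum_(j < k.+1) ((S j - S j.+1) * (x c + \rsum_(i < j) (lam i * u i c))).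
  apply: eq_bigr => j _; rewrite chain_ptsE; last by rewrite -ltnS.
  by rewrite /vadd vsumE.
rewrite (abel_summation k S (fun i => lam i * u i c)) {3}/S ltnn {1}/S /=.
have := res0 c; rewrite residualE // {1}/vsub => e.
have -> : \rsum_(i < k) (S i.+1 * (lam i * u i c)) =
          \rsum_(l < k) (dot (vsub y x) (u l) * u l c).
  apply: eq_bigr => i _; rewrite /S ltn_ord /=; field.
  by have := lam0 (ltn_ord i); lra.
by move: e; rewrite -/k Rmult_0_l /u; slra.
Qed.

Lemma rho_pos j i : (j < k)%N -> 0 < rho j i.
Proof.
case: frame => _ [_ H] lt; have [/(_ i) ne _] := H j lt.
have := norm_ge0 (residual us j (z i)); rewrite /rho => ge; case: ge => // e.
by case: ne.
Qed.

Lemma dot_over_rho j : (j < k)%N -> Un_cv (fun i => / rho j i * dot (z i) (u j)) 1.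
Proof.
case: frame => _ [_ H] lt; have [_ /(dot_cv (u j))] := H j lt.
rewrite {2}/u dot_nth // eqxx; apply: Un_cv_eq => i.
by rewrite dotZl dot_residual.
Qed.

(** The normalised residual tends to [u j], so removing its component along [u j] leaves a null
    sequence: each residual is negligible against the preceding one. *)
Lemma residual_over_rho j : (j < k)%N ->
  seq_cv (fun i => vscale (/ rho j i) (residual us j.+1 (z i))) (@vzero n).
Proof.
move=> lt; apply/seq_cvP => c; case: frame => _ [_ H]; have [_ /seq_cvP/(_ c) cvc] := H j lt.
have := CV_minus _ _ _ _ cvc (CV_mult _ _ _ _ (dot_over_rho lt) (Un_cv_cst (u j c))).
rewrite {1}/u Rmult_1_l Rminus_diag; apply: Un_cv_eq => i.
by rewrite residualS // /vscale /vsub /rho /residual -/(u j) /z /vsub; ring.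
Qed.

(** The component along one frame vector is asymptotic to its residual norm, and the component along
    the next is negligible against it. The first comparison, with the constant 1, follows from
    convergence to [x]. *)
Lemma slope_decreasing j : (j < k)%N ->
  eventually (fun i => slope j.+1 (xs i) - slope j (xs i) < 0).
Proof.
case: j => [|j] lt /=.
  have := dot_cv (u 0) cv; move=> /(CV_minus _ _ _ _)/(_ (Un_cv_cst (dot x (u 0)))).
  move=> /(CV_mult _ _ _ _)/(_ (Un_cv_cst (/ lam 0))).
  move=> /(CV_minus _ _ _ _)/(_ (Un_cv_cst 1))/Un_cv_neg H.
  have /H : (dot x (u 0) - dot x (u 0)) * / lam 0 - 1 < 0 by rewrite Rminus_diag; lra.
  by apply: eventually_imp => i; rewrite dotBl.
have l1 := lam0 lt; have l0 := lam0 (ltnW lt).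
have := residual_over_rho (ltnW lt) => /(dot_cv (u j.+1)).
rewrite dot0l => /(CV_mult _ _ _ _)/(_ (Un_cv_cst (/ lam j.+1))) c1.
have c2 := CV_mult _ _ _ _ (dot_over_rho (ltnW lt)) (Un_cv_cst (/ lam j)).
have /Un_cv_neg := CV_minus _ _ _ _ c1 c2.
have li : 0 < / lam j by apply: Rinv_0_lt_compat.
move=> H; have /H : 0 * / lam j.+1 - 1 * / lam j < 0 by lra.
apply: eventually_imp => i; rewrite dotZl dot_residual // -/(u _).
have rp := rho_pos i (ltnW lt); have ri : 0 < / rho j i by apply: Rinv_0_lt_compat.
rewrite -/(z i) /Rdiv => neg.
apply: (Rmult_lt_reg_l (/ rho j i)) => //; rewrite Rmult_0_r.
by move: neg; rewrite !Rmult_minus_distr_l -!Rmult_assoc.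
Qed.

Lemma slope_last_pos : eventually (fun i => 0 < slope k (xs i)).
Proof.
have k0 : (k.-1 < k)%N by rewrite prednK //; case: frame.
have := dot_over_rho k0 => /Un_cv_pos H; have /H : 0 < 1 by lra.
rewrite -[X in slope X](@prednK k) => [|]; last by case: frame.
apply: eventually_imp => i pos /=; have rp := rho_pos i k0.
apply: Rdiv_lt_0_compat; last exact: lam0.
apply: (Rmult_lt_reg_l (/ rho k.-1 i)); first exact: Rinv_0_lt_compat.
by rewrite Rmult_0_r.
Qed.

(** The total violation of the equations and inequalities that describe C. *)
Definition chain_gauge y := norm1 (residual us k (vsub y x)) +
  (\rsum_(j < k) Rmax 0 (slope j.+1 y - slope j y) + Rmax 0 (- slope k y)).

Lemma chain_gauge_ge0 y : 0 <= chain_gauge y.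
Proof.
have := norm1_ge0 (residual us k (vsub y x)); have := Rmax_l 0 (- slope k y).
have : 0 <= \rsum_(j < k) Rmax 0 (slope j.+1 y - slope j y).
  by apply: rsum_ge0 => j; apply: Rmax_l.
by rewrite /chain_gauge; slra.
Qed.

Lemma chain_gauge_eq0 y : chain_gauge y = 0 -> conv (chain_pts x lam us k) y.
Proof.
have n0 := norm1_ge0 (residual us k (vsub y x)); have m0 := Rmax_l 0 (- slope k y).
have s0 : 0 <= \rsum_(j < k) Rmax 0 (slope j.+1 y - slope j y).
  by apply: rsum_ge0 => j; apply: Rmax_l.
rewrite /chain_gauge => e; apply: conv_chain.
- move=> c; have : norm1 (residual us k (vsub y x)) = 0 by slra.
  move=> /rsum_sum_eq0 H; apply: NNPP => /Rabs_no_R0; apply; apply: H => i.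
  exact: Rabs_pos.
- move=> j lt; have : \rsum_(j < k) Rmax 0 (slope j.+1 y - slope j y) = 0 by slra.
  move=> /rsum_sum_eq0 H; have := H (fun _ => Rmax_l _ _) (Ordinal lt).
  rewrite [nat_of_ord _]/=; have := Rmax_r 0 (slope j.+1 y - slope j y).
  by move: (slope j.+1 y) => a; slra.
- by have := Rmax_r 0 (- slope k y); slra.
Qed.

(** Eventually the slope inequalities hold along the sequence, and the gauge reduces to the size of
    the last residual. This is negligible against [rho k.-1], to which the last coordinate is
    asymptotic. *)
Lemma gauge_ratio_unbounded m :
  eventually (fun i => INR m * chain_gauge (xs i) < Rabs (dot (z i) (u k.-1))).
Proof.
have k0 : (k.-1 < k)%N by rewrite prednK //; case: frame.
have c1 := dot_over_rho k0.
have c2 := CV_mult _ _ _ _ (Un_cv_cst (INR m)) (seq_cv_norm1 (residual_over_rho k0)).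
have /Un_cv_pos H := CV_minus _ _ _ _ c1 c2.
have /H pos : 0 < 1 - INR m * 0 by lra.
have dec := eventually_all slope_decreasing.
have := eventually_and pos (eventually_and dec slope_last_pos).
apply: eventually_imp => i [{}pos [{}dec last0]].
have -> : chain_gauge (xs i) = norm1 (residual us k (z i)).
  rewrite /chain_gauge rsum_eq0; last first.
    by move=> j; rewrite Rmax_left //; have := dec j (ltn_ord j); slra.
  by rewrite Rmax_left; [rewrite /z; ring | lra].
have rp := rho_pos i k0; have ri : 0 < / rho k.-1 i by apply: Rinv_0_lt_compat.
apply: Rlt_le_trans (Rle_abs _).
apply: (Rmult_lt_reg_l (/ rho k.-1 i)) => //.
suff e : norm1 (vsub (vscale (/ rho k.-1 i) (residual us k.-1.+1 (z i))) (@vzero n)) =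
       / rho k.-1 i * norm1 (residual us k (z i)).
  move: pos; rewrite e => pos.
  have -> : / rho k.-1 i * (INR m * norm1 (residual us k (z i))) =
            INR m * (/ rho k.-1 i * norm1 (residual us k (z i))) by ring.
  by lra.
rewrite prednK; last by case: frame.
rewrite /norm1 rsumZ; apply: eq_bigr => c _; rewrite /vsub /vscale /vzero Rminus_0_r Rabs_mult.
by rewrite (Rabs_pos_eq (/ rho k.-1 i)) //; lra.
Qed.

Lemma cellwise_dot K j : cellwise_affine K (fun y => dot (vsub y x) (u j)).
Proof.
apply: cellwise_ext (cellwise_affineI K (u j, - dot x (u j))) => y.
by rewrite /ev /= dotBl (dotC (u j)); ring.
Qed.

Lemma cellwise_slope K j : cellwise_affine K (slope j).
Proof.
case: j => [|j]; first exact: cellwise_const.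
by apply: cellwise_ext (cellwise_scale (/ lam j) (cellwise_dot K j)) => y /=; rewrite /Rdiv; ring.
Qed.

Lemma cellwise_chain_gauge K : cellwise_affine K chain_gauge.
Proof.
apply: cellwise_add; last first.
  apply: cellwise_add; last first.
    apply: cellwise_max0.
    by apply: cellwise_ext (cellwise_scale (-1) (cellwise_slope K k)) => y; ring.
  by apply: cellwise_sum => j; apply: cellwise_max0; apply: cellwise_sub; apply: cellwise_slope.
apply: cellwise_sum => c; apply: cellwise_abs.
apply: (cellwise_ext (f := fun y => (y c - x c) - \rsum_(l < k) (u l c * dot (vsub y x) (u l)))).
  move=> y; rewrite residualE // {2}/vsub; congr (_ - _).
  by apply: eq_bigr => l _; rewrite Rmult_comm.
apply: cellwise_sub.
  by apply: cellwise_sub; [apply: cellwise_coord | apply: cellwise_const].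
by apply: cellwise_sum => l; apply/cellwise_scale/cellwise_dot.
Qed.

End OutgoingTangent.

Lemma outgoing_tangent_unbounded_ratio n (X K : vec n -> Prop) x us : outgoing_tangent X x us ->
  exists f g : vec n -> R, [/\ cellwise_affine K f, cellwise_affine K g,
    forall y, 0 <= f y /\ 0 <= g y,
    forall y, X y -> g y = 0 -> f y = 0 &
    forall m, exists y, X y /\ INR m * g y < f y].
Proof.
move=> [[xs [Xxs [cv frame]]] [lam [lam0 H]]].
exists (fun y => Rabs (dot (vsub y x) (nth (@vzero n) us (size us).-1))), (chain_gauge us x lam).
split.
- exact/cellwise_abs/cellwise_dot.
- exact: cellwise_chain_gauge.
- by move=> y; split; [apply: Rabs_pos | apply: chain_gauge_ge0].
- move=> y Xy /(chain_gauge_eq0 lam0) cy.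
  have [cy' _] := (H y).1 (conj cy Xy).
  by rewrite (chain_face_dot frame cy') Rabs_R0.
- move=> m; have [N HN] := gauge_ratio_unbounded frame cv lam0 m.
  by exists (xs N); split=> //; apply: HN.
Qed.

(** * From an unbounded ratio to an outgoing tangent *)

(** Subsequences are given by any [phi] with [k <= phi k], monotone or not: this preserves limits
    and is stable under composition. *)
Lemma Un_cv_subseq u l (phi : nat -> nat) : (forall k, (k <= phi k)%N) ->
  Un_cv u l -> Un_cv (fun k => u (phi k)) l.
Proof.
move=> ge /Un_cvP cv; apply/Un_cvP => eps /cv[N HN]; exists N => k Nk.
by apply: HN; apply: leq_trans Nk (ge k).
Qed.

Lemma inv_INR_cv0 : Un_cv (fun k => / INR k.+1) 0.
Proof.
apply/Un_cvP => eps e0; have [N HN] := INR_unbounded (/ eps); exists N => k Nk.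
have Nk' : INR N <= INR k by apply: le_INR; apply/leP.
have ie : 0 < / eps by apply: Rinv_0_lt_compat.
rewrite Rminus_0_r S_INR Rabs_pos_eq; last by apply/Rlt_le/Rinv_0_lt_compat; lra.
by rewrite -(Rinv_inv eps); apply: Rinv_lt_contravar; [apply: Rmult_lt_0_compat|]; lra.
Qed.

Lemma bounded_cv_subseq (u : nat -> R) B : (forall k, Rabs (u k) <= B) ->
  exists (phi : nat -> nat) l, (forall k, (k <= phi k)%N) /\ Un_cv (fun k => u (phi k)) l.
Proof.
move=> uB; have [|l adh] := Bolzano_Weierstrass u _ (compact_P3 (- B) B).
  by move=> k; have := uB k; rewrite /Rabs; case: Rcase_abs; slra.
(* Beyond every index there are terms within [/ INR k.+1] of the adherence value [l]. *)
have ex k : exists p, (k <= p)%N /\ Rabs (u p - l) < / INR k.+1.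
  have pos : 0 < / INR k.+1 by apply: Rinv_0_lt_compat; apply: lt_0_INR; apply/ltP.
  have [|p [kp lt]] := adh (fun y => Rabs (y - l) < / INR k.+1) k.
    by exists (mkposreal _ pos).
  by exists p; split=> //; apply/leP.
pose phi k := proj1_sig (constructive_indefinite_description _ (ex k)).
have phiP k : (k <= phi k)%N /\ Rabs (u (phi k) - l) < / INR k.+1.
  by rewrite /phi; case: constructive_indefinite_description.
exists phi, l; split=> [k|]; first by case: (phiP k).
have /Un_cvP c0 := inv_INR_cv0; apply/Un_cvP => eps /c0; apply: eventually_imp => k.
rewrite Rminus_0_r; have [_] := phiP k; have := Rle_abs (/ INR k.+1).
by move: (/ INR k.+1) (Rabs (u (phi k) - l)) => a b; slra.
Qed.

Lemma scaled_nonneg_eq0 a b : 0 <= a -> (forall m, INR m * a <= b) -> a = 0.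
Proof.
move=> a0 H; apply: NNPP => ne; have apos : 0 < a by lra.
have [m Hm] := INR_unbounded (b / a); have := H m.
have e : b / a * a = b by field.
have : b / a * a < INR m * a by apply: Rmult_lt_compat_r; lra.
by lra.
Qed.

(** The hypothesis says that the first nonzero coefficient is positive; for small [eps] it dominates
    the later terms. If [c 0] vanishes, a factor [eps] is taken out and induction applies. *)
Lemma lex_nonneg_partial_sums J (c : nat -> R) :
  (forall j, (j <= J)%N -> (forall i, (i < j)%N -> c i = 0) -> 0 <= c j) ->
  exists d, 0 < d /\ forall eps, 0 < eps <= d -> forall j, (j <= J)%N ->
    0 <= \rsum_(i < j.+1) (c i * eps ^ i).
Proof.
elim: J c => [|J IH] c lex.
  exists 1; split=> [|eps _ j]; first by lra.
  rewrite leqn0 => /eqP->; rewrite (rsumS 0 (fun i => c i * eps ^ i)) big_ord0 /=.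
  rewrite Rplus_0_l Rmult_1_r; exact: lex.
have shift eps j : \rsum_(i < j.+1) (c i * eps ^ i) =
    c 0%N + eps * \rsum_(i < j) (c i.+1 * eps ^ i).
  rewrite (rsum_recl j (fun i => c i * eps ^ i)) rsumZ /= Rmult_1_r; congr (_ + _).
  by apply: eq_bigr => i _; ring.
have [|c0|c00] := Rle_lt_or_eq_dec 0 (c 0%N); first exact: lex.
  pose A := \rsum_(i < J.+1) Rabs (c i.+1).
  have A0 : 0 <= A by apply: rsum_ge0 => i; apply: Rabs_pos.
  (* For [eps <= 1] the remaining sum is at most [A], so [eps * A] stays below [c 0]. *)
  exists (Rmin 1 (c 0%N / (A + 1))); split.
    by apply: Rmin_pos; [lra | apply: Rdiv_lt_0_compat; lra].
  move=> eps [e0 le] j jJ; rewrite shift.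
  have le1 := Rle_trans _ _ _ le (Rmin_l _ _); have le2 := Rle_trans _ _ _ le (Rmin_r _ _).
  have e2 : eps * (A + 1) <= c 0%N.
    have -> : c 0%N = c 0%N / (A + 1) * (A + 1) by field; lra.
    by apply: Rmult_le_compat_r; lra.
  have : Rabs (\rsum_(i < j) (c i.+1 * eps ^ i)) <= A.
    apply: Rle_trans (rsum_abs _) _.
    apply: (@Rle_trans _ (\rsum_(i < j) Rabs (c i.+1))).
      apply: rsum_le => i; rewrite Rabs_mult -{2}(Rmult_1_r (Rabs (c i.+1))).
      apply: Rmult_le_compat_l; first exact: Rabs_pos.
      have p0 : 0 <= eps ^ i by apply: pow_le; lra.
      rewrite Rabs_pos_eq //; rewrite -(pow1 i); apply: pow_incr; lra.
    rewrite /A -(subnKC jJ); elim: (J.+1 - j)%N => [|d]; first by rewrite addn0; apply: Rle_refl.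
    rewrite addnS (rsumS (j + d) (fun i => Rabs (c i.+1))).
    by have := Rabs_pos (c (j + d).+1); slra.
  move: (\rsum_(i < j) _) => s; rewrite /Rabs; case: Rcase_abs => ? ?; nra.
have [j jJ z|d [d0 H]] := IH (fun i => c i.+1).
  by apply: lex => // -[|i] lt; [rewrite -c00 | apply: z].
exists d; split=> // eps [e0 le] [|j] jJ; rewrite shift -c00.
  by rewrite big_ord0; lra.
by rewrite Rplus_0_l; apply: Rmult_le_pos; [lra | apply: H].
Qed.

(** * Construction of Frenet frames along subsequences *)

Section Frames.
Context (n : nat).
Implicit Types (x y z u : vec n) (xs : nat -> vec n) (us : seq (vec n)).

Lemma bounded_seq_cv_subseq xs B : (forall k c, Rabs (xs k c) <= B) ->
  exists (phi : nat -> nat) u, (forall k, (k <= phi k)%N) /\ seq_cv (fun k => xs (phi k)) u.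
Proof.
move=> xB.
have H m : exists phi : nat -> nat, (forall k, (k <= phi k)%N) /\
    forall c : 'I_n, (c < m)%N -> exists l, Un_cv (fun k => xs (phi k) c) l.
  elim: m => [|m [phi [ge cv]]]; first by exists id.
  have [mn|nm] := ltnP m n; last first.
    exists phi; split=> // c _; apply: cv; apply: leq_trans (ltn_ord c) nm.
  have [psi [l [ge' cv']]] := @bounded_cv_subseq (fun k => xs (phi k) (Ordinal mn)) B (fun k => xB _ _).
  exists (fun k => phi (psi k)); split=> [k|c]; first exact: leq_trans (ge' k) (ge _).
  rewrite ltnS leq_eqVlt => /orP[/eqP cm|/cv[l' cvl]].
    by exists l; have -> : c = Ordinal mn by apply: val_inj.
  by exists l'; apply: (Un_cv_subseq ge' cvl).
have [phi [ge cv]] := H n.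
have ex c : exists l, Un_cv (fun k => xs (phi k) c) l by apply: cv.
exists phi, (fun c => proj1_sig (constructive_indefinite_description _ (ex c))); split=> //.
by apply/seq_cvP => c; case: constructive_indefinite_description.
Qed.

Lemma dot_residual_prev us j l z : orthonormal us -> (j <= size us)%N -> (l < j)%N ->
  dot (residual us j z) (nth (@vzero n) us l) = 0.
Proof.
move=> on ju lj; rewrite /residual dotBl projE // (dotC (bigop _ _ _)) dot_sumr.
rewrite (eq_bigr (fun i : 'I_j => (if i == l :> nat then 1 else 0) * dot z (nth (@vzero n) us i))).
  by rewrite (rsum_delta 1 (fun i => dot z (nth (@vzero n) us i))) // Rmult_1_l Rminus_diag.
move=> i _; rewrite dotZr dot_nth //; first by rewrite Rmult_comm eq_sym.
  exact: leq_trans lj ju.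
exact: leq_trans (ltn_ord i) ju.
Qed.

(* Bessel's inequality for the standard basis vectors, summed over the basis. *)
Lemma orthonormal_size us : orthonormal us -> (size us <= n)%N.
Proof.
move=> on; set k := size us.
have bessel (c : 'I_n) : \rsum_(j < k) (nth (@vzero n) us j c * nth (@vzero n) us j c) <= 1.
  pose e : vec n := fun i => if i == c then 1 else 0.
  have ee y : dot e y = y c by rewrite /dot /e rsum_deltaI Rmult_1_l.
  have := dot_ge0 (residual us k e).
  rewrite {2}/residual dotBr projE // dot_sumr rsum_eq0 => [|j]; last first.
    by rewrite dotZr dot_residual_prev // Rmult_0_r.
  rewrite Rminus_0_r (dotC _ e) ee residualE // {1}/e eqxx.
  rewrite (eq_bigr (fun j : 'I_k => nth (@vzero n) us j c * nth (@vzero n) us j c)) => [|j _].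
    by slra.
  by rewrite ee.
apply/leP; apply: INR_le.
have -> : INR k = \rsum_(c < n) \rsum_(j < k) (nth (@vzero n) us j c * nth (@vzero n) us j c).
  rewrite exchange_big -[LHS]Rmult_1_r -rsum_const; apply: eq_bigr => j _.
  by have := on j j (ltn_ord j) (ltn_ord j); rewrite eqxx.
rewrite -[INR n]Rmult_1_r -rsum_const; exact: rsum_le.
Qed.

Lemma seq_cv_subseq xs x (phi : nat -> nat) : (forall k, (k <= phi k)%N) ->
  seq_cv xs x -> seq_cv (fun k => xs (phi k)) x.
Proof. by move=> ge /seq_cvP H; apply/seq_cvP => c; apply: (Un_cv_subseq ge (H c)). Qed.

(** A Frenet frame that may be empty, so that the search can start from [[::]]. *)
Definition frame_along xs x us := orthonormal us /\
  forall j, (j < size us)%N -> (forall i, norm (residual us j (vsub (xs i) x)) <> 0) /\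
    seq_cv (fun i => vscale (/ norm (residual us j (vsub (xs i) x))) (residual us j (vsub (xs i) x)))
      (nth (@vzero n) us j).

(** The normalised residuals are bounded and have a convergent subsequence; unit length and
    orthogonality to the earlier vectors pass to the limit. *)
Lemma frame_along_extend xs x us : frame_along xs x us ->
  (forall i, norm (residual us (size us) (vsub (xs i) x)) <> 0) ->
  exists (phi : nat -> nat) u, (forall k, (k <= phi k)%N) /\
    frame_along (fun k => xs (phi k)) x (rcons us u).
Proof.
move=> [on fr] res0; set k := size us in res0 *.
pose r i := residual us k (vsub (xs i) x); pose e i := vscale (/ norm (r i)) (r i).
have rp i : 0 < norm (r i) by case: (norm_ge0 (r i)) => // /esym/res0.
have dee i : dot (e i) (e i) = 1.
  rewrite dotZl dotZr -norm_sqr; have := rp i; move: (norm (r i)) => a; intros; field; lra.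
have ebound i c : Rabs (e i c) <= 1.
  by have := coord_le_norm (e i) c; rewrite /norm dee sqrt_1.
have [phi [u [ge cv]]] := bounded_seq_cv_subseq ebound.
have duu : dot u u = 1.
  have c1 : Un_cv (fun i => dot (e (phi i)) (e (phi i))) (dot u u).
    by apply: Un_cv_sum => c; have /seq_cvP/(_ c) cvc := cv; apply: CV_mult.
  apply: UL_sequence c1 _; apply: Un_cv_eq (Un_cv_cst 1) => i; by rewrite dee.
have duj j : (j < k)%N -> dot u (nth (@vzero n) us j) = 0.
  move=> jk; apply: UL_sequence (dot_cv (nth (@vzero n) us j) cv) _.
  apply: Un_cv_eq (Un_cv_cst 0) => i.
  by rewrite dotZl /r dot_residual_prev // Rmult_0_r.
have resE j z : (j <= k)%N -> residual (rcons us u) j z = residual us j z.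
  by move=> jk; rewrite /residual -cats1 takel_cat.
exists phi, u; split=> //; split.
  move=> j l; rewrite size_rcons !ltnS -/k !nth_rcons -/k => jk lk.
  case: (ltngtP j k) jk => // [jk|->] _.
    case: (ltngtP l k) lk => // [lk|->] _; first exact: on.
    by rewrite dotC duj // ltn_eqF.
  case: (ltngtP l k) lk => // lk _.
  by rewrite duj.
move=> j; rewrite size_rcons ltnS -/k => jk.
have -> : (fun i => vscale (/ norm (residual (rcons us u) j (vsub (xs (phi i)) x)))
              (residual (rcons us u) j (vsub (xs (phi i)) x))) =
       (fun i => vscale (/ norm (residual us j (vsub (xs (phi i)) x))) (residual us j (vsub (xs
           (phi i)) x))).
  by apply: functional_extensionality => i; rewrite resE.
split=> [i|].
  rewrite resE //; case: (ltngtP j k) jk => // [jk|->] _; last exact: res0.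
  by have [H _] := fr j jk; apply: H.
rewrite nth_rcons -/k; case: (ltngtP j k) jk => // [jk|->] _; last exact: cv.
by have [_ H] := fr j jk; apply: seq_cv_subseq ge H.
Qed.

(** As [h] vanishes at [x] and its linear part on the earlier vectors, [h] at [xs i] sees only the
    residual, whose direction tends to the vector of index [j]. *)
Lemma frame_along_directional xs x us j (h : affine n) : frame_along xs x us ->
  (j < size us)%N -> ev h x = 0 -> (forall l, (l < j)%N -> dot h.1 (nth (@vzero n) us l) = 0) ->
  Un_cv (fun i => / norm (residual us j (vsub (xs i) x)) * ev h (xs i)) (dot h.1 (nth (@vzero n) us j)).
Proof.
move=> [on fr] ju hx perp; have [_ /(dot_cv h.1)] := fr j ju.
rewrite dotC; apply: Un_cv_eq => i.
rewrite dotZl dot_residual_perp //; last exact: ltnW.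
by congr (_ * _); move: hx; rewrite dotBl /ev !(dotC _ h.1); lra.
Qed.

Lemma ev_cv (h : affine n) xs x : seq_cv xs x -> Un_cv (fun i => ev h (xs i)) (ev h x).
Proof.
move=> /(dot_cv h.1) cv; rewrite /ev (dotC _ x).
apply: Un_cv_eq (CV_plus _ _ _ _ cv (Un_cv_cst h.2)) => i.
by rewrite (dotC h.1).
Qed.

Lemma ev_chain (h : affine n) x lam us m j : (j <= m)%N ->
  ev h (nth (@vzero n) (chain_pts x lam us m) j) =
  ev h x + \rsum_(i < j) (lam i * dot h.1 (nth (@vzero n) us i)).
Proof.
move=> jm; rewrite chain_ptsE // /ev dotDr dot_sumr.
rewrite Rplus_assoc (Rplus_comm _ h.2) -Rplus_assoc; congr (_ + _).
by apply: eq_bigr => i _; rewrite dotZr.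
Qed.

Lemma conv_polyhedron_sub (ps : seq (vec n)) (l : list (affine n)) y :
  (forall j, (j < size ps)%N -> polyhedron l (nth (@vzero n) ps j)) -> conv ps y -> polyhedron l y.
Proof.
move=> H [w [w0 [w1 yE]]] h hl; rewrite (ev_conv h w1 yE); apply: rsum_ge0 => j.
by apply: Rmult_le_pos; [apply: w0 | apply: H].
Qed.

End Frames.

(** * Localising the unbounded ratio *)

Lemma unbounded_in_cell n (X K : vec n -> Prop) (f g : vec n -> R) :
  cellwise_affine K f -> cellwise_affine K g -> (forall x, X x -> K x) ->
  (forall y, 0 <= f y /\ 0 <= g y) ->
  (forall m, exists y, X y /\ INR m * g y < f y) ->
  exists l hf hg, (forall y, K y -> polyhedron l y -> f y = ev hf y /\ g y = ev hg y) /\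
    forall m, exists y, [/\ X y, polyhedron l y & INR m * g y < f y].
Proof.
move=> [cs [cov aff]] [cs' [cov' aff']] XK fg0 unb; apply: NNPP => no.
(* Were the ratio bounded on each of the finitely many intersections of cells, the largest bound
   would hold on [X]. *)
have bnd q : exists m, In q (list_prod cs cs') ->
    forall y, X y -> polyhedron q.1.1 y -> polyhedron q.2.1 y -> f y <= INR m * g y.
  apply: NNPP => nq; apply: no; exists (q.1.1 ++ q.2.1)%list, q.1.2, q.2.2.
  have qin : In q (list_prod cs cs').
    by apply: NNPP => nin; apply: nq; exists 0%N => /nin.
  case: q qin nq => c c' /in_prod_iff[cin cin'] nq; split.
    by move=> y Ky /polyhedron_app[cy cy']; split; [apply: aff | apply: aff'].
  move=> m; apply: NNPP => ny; apply: nq; exists m => _ y Xy cy cy'.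
  by apply: Rnot_lt_le => lt; apply: ny; exists y; split=> //; apply/polyhedron_app.
pose mq q := proj1_sig (constructive_indefinite_description _ (bnd q)).
have mqP q : In q (list_prod cs cs') ->
    forall y, X y -> polyhedron q.1.1 y -> polyhedron q.2.1 y -> f y <= INR (mq q) * g y.
  by rewrite /mq; case: constructive_indefinite_description.
have [B [_ HB]] := list_bound (fun q => INR (mq q)) (list_prod cs cs').
have [m Hm] := INR_unbounded B; have [y [Xy lt]] := unb m.
have [c [cin cy]] := cov y (XK _ Xy); have [c' [cin' cy']] := cov' y (XK _ Xy).
have qin : In (c, c') (list_prod cs cs') by apply/in_prod_iff.
have := mqP _ qin y Xy cy cy'; have := HB _ qin; have := fg0 y.
by move: (mq _) => a; snra.
Qed.

(** Otherwise every point has a neighbourhood with a bound on the ratio, and finitely many of these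
    cover [X]. *)
Lemma unbounded_near_point n (X P : vec n -> Prop) (f g : vec n -> R) : compact_set X ->
  (forall y, 0 <= f y /\ 0 <= g y) ->
  (forall m, exists y, [/\ X y, P y & INR m * g y < f y]) ->
  exists x, X x /\ forall r m, 0 < r ->
    exists y, [/\ X y, P y, INR m * g y < f y & norm1 (vsub y x) < r].
Proof.
move=> cX fg0 unb; apply: NNPP => no.
have [x Xx|l H] := @compact_finite_balls n X nat
    (fun x r m => forall y, X y -> P y -> norm1 (vsub y x) < r -> f y <= INR m * g y) cX.
  apply: NNPP => nrm; apply: no; exists x; split=> // r m r0; apply: NNPP => ny.
  apply: nrm; exists r, m; split=> // y Xy Py lt; apply: Rnot_lt_le => lt'.
  by apply: ny; exists y.
have [B [_ HB]] := list_bound (fun q => INR q.2) l.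
have [m Hm] := INR_unbounded B; have [y [Xy Py lt]] := unb m.
have [q [ql Hq near]] := H y Xy.
by have := Hq y Xy Py near; have := HB q ql; have := fg0 y; snra.
Qed.

(** * The search for an outgoing tangent *)

Section FrameSearch.
Context (n : nat) (X K : vec n -> Prop) (f g : vec n -> R).
Context (l : list (affine n)) (hf hg : affine n) (x : vec n).
Hypotheses (XK : forall y, X y -> K y)
  (fgE : forall y, K y -> polyhedron l y -> f y = ev hf y /\ g y = ev hg y)
  (zero : forall y, X y -> g y = 0 -> f y = 0)
  (fx : ev hf x = 0) (gx : ev hg x = 0).

Definition ratio_seq (xs : nat -> vec n) :=
  [/\ forall i, X (xs i) /\ polyhedron l (xs i), seq_cv xs x,
      forall i, 0 < ev hf (xs i) /\ 0 <= ev hg (xs i) &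
      forall m, eventually (fun i => INR m * ev hg (xs i) < ev hf (xs i))].

Lemma ratio_seq_subseq xs (phi : nat -> nat) : (forall k, (k <= phi k)%N) ->
  ratio_seq xs -> ratio_seq (fun k => xs (phi k)).
Proof.
move=> ge [Xxs cv pos unb]; split=> //; first exact: seq_cv_subseq.
by move=> m; have [N HN] := unb m; exists N => k Nk; apply: HN; apply: leq_trans (ge k).
Qed.

(** On the simplex C the form [hg] vanishes, and [hf] is a positive multiple of the last barycentric
    weight. Once C lies in the cell, the implication from [g = 0] to [f = 0] on [X] forces that
    weight to vanish. *)
Lemma outgoing_of_frame xs us : ratio_seq xs -> frame_along xs x us -> (0 < size us)%N ->
  (forall j, (j < (size us).-1)%N -> dot hf.1 (nth (@vzero n) us j) = 0) ->
  (forall j, (j < size us)%N -> dot hg.1 (nth (@vzero n) us j) = 0) ->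
  0 < dot hf.1 (nth (@vzero n) us (size us).-1) -> outgoing_tangent X x us.
Proof.
move=> [Xxs cv pos unb] fr k0 f0 g0 alpha; set k := size us in k0 f0 g0 alpha *.
have kE : k.-1.+1 = k by rewrite prednK.
split.
  by exists xs; split; [move=> i; case: (Xxs i) | split=> //; case: fr].
(* One [d] serves all forms [h] of the cell: with [lam i = d ^ i.+1] every chain point satisfies
   [h >= 0]. *)
have [h d e H [e0 le] eps le'|h hl|d [d0 H]] := @list_delta _ (fun h d => forall eps, 0 < eps <= d
    -> forall j, (j <= k)%N ->
    0 <= ev h x + \rsum_(i < j) (eps ^ i.+1 * dot h.1 (nth (@vzero n) us i))) l.
- by apply: H; lra.
(* The value of [h] at [x] followed by its derivatives along the frame. An entry preceded by zeros
   only is a limit of nonnegative numbers, since the sequence stays in the cell. *)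
- pose c i := if i is j.+1 then dot h.1 (nth (@vzero n) us j) else ev h x.
  have [|d [d0 H]] := @lex_nonneg_partial_sums k c.
    move=> [|j] jk z /=.
      by apply: Un_cv_ge0 (ev_cv h cv) _ => i; apply: (Xxs i).2.
    apply: Un_cv_ge0 (frame_along_directional fr jk (z 0%N isT) (fun l lj => z l.+1 lj)) _ => i.
    apply: Rmult_le_pos; last exact: (Xxs i).2.
    apply/Rlt_le/Rinv_0_lt_compat; case: fr => _ /(_ j jk)[/(_ i) ne _].
    by case: (norm_ge0 (residual us j (vsub (xs i) x))) => // /esym/ne.
  exists d; split=> // eps le j jk; have := H eps le j jk.
  rewrite (rsum_recl j (fun i => c i * eps ^ i)) /= Rmult_1_r.
  rewrite (eq_bigr (fun i : 'I_j => eps ^ i.+1 * dot h.1 (nth (@vzero n) us i))) //.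
  by move=> i _; rewrite Rmult_comm.
pose lam i := d ^ i.+1; have lam0 i : 0 < lam i by apply: pow_lt.
exists lam; split=> // y; split; last first.
  move=> [[w [w0 [w1 yE]]] Xy]; split=> //.
  rewrite size_mkseq kE in w0 w1 yE.
  exists (fun j => if (j < k)%N then w j else 0); rewrite size_mkseq; split; [|split].
  - by move=> j _; case: ifP => jk; [apply: w0 | lra].
  - rewrite (rsumS k (fun j => if (j < k)%N then w j else 0)) ltnn Rplus_0_r -w1.
    by apply: eq_bigr => j _; rewrite ltn_ord.
  move=> i; rewrite yE.
  rewrite (rsumS k (fun j => (if (j < k)%N then w j else 0) * nth (@vzero n) (chain_pts x lam us k)
      j i)).
  rewrite ltnn Rmult_0_l Rplus_0_r; apply: eq_bigr => j _.
  by rewrite ltn_ord !chain_ptsE //; [exact: ltnW | rewrite -ltnS kE].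
move=> [cy Xy]; split=> //.
have ly : polyhedron l y.
  apply: conv_polyhedron_sub cy => j; rewrite size_mkseq ltnS => jk h hl.
  by rewrite ev_chain //; apply: (H h hl d (conj d0 (Rle_refl d))).
have [fy gy] := fgE (XK Xy) ly.
case: cy => w [w0 [w1 yE]]; rewrite size_mkseq in w0 w1 yE.
have gy0 : g y = 0.
  rewrite gy (ev_conv hg w1 yE); apply: rsum_eq0 => j.
  have jk : (j <= k)%N by rewrite -ltnS.
  rewrite ev_chain // gx rsum_eq0; first by ring.
  by move=> i; rewrite g0 ?Rmult_0_r //; apply: leq_trans jk.
have := zero Xy gy0; rewrite fy (ev_conv hf w1 yE).
have low j : (j < k)%N -> ev hf (nth (@vzero n) (chain_pts x lam us k) j) = 0.
  move=> jk; rewrite ev_chain ?(ltnW jk) // fx rsum_eq0 ?Rplus_0_l //.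
  by move=> i; rewrite f0 ?Rmult_0_r //; apply: leq_trans (ltn_ord i) _; rewrite -ltnS kE.
rewrite (rsumS k (fun j => w j * ev hf (nth (@vzero n) (chain_pts x lam us k) j))).
rewrite rsum_eq0 => [|j]; last by rewrite low // Rmult_0_r.
rewrite ev_chain // fx -kE.
rewrite (rsumS k.-1 (fun i => lam i * dot hf.1 (nth (@vzero n) us i))).
rewrite rsum_eq0 => [|j]; last by rewrite f0 // Rmult_0_r.
rewrite kE !Rplus_0_l => wk.
(* Among the chain points, only the last has a nonzero value of [hf]. *)
have {}wk : w k = 0.
  have ap : 0 < lam k.-1 * dot hf.1 (nth (@vzero n) us k.-1) by apply: Rmult_lt_0_compat.
  by apply: (Rmult_eq_reg_r (lam k.-1 * dot hf.1 (nth (@vzero n) us k.-1))); lra.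
exists w; rewrite size_mkseq kE; split; [|split].
- by move=> j jk; apply: w0; apply: leq_trans jk _.
- by move: w1; rewrite rsumS wk Rplus_0_r.
move=> i; rewrite yE (rsumS k (fun j => w j * nth (@vzero n) (chain_pts x lam us k) j i)) wk.
rewrite Rmult_0_l Rplus_0_r; apply: eq_bigr => j _.
by rewrite !chain_ptsE //; [rewrite -ltnS kE | exact: ltnW].
Qed.

(** With a zero residual, [hf] would take at [xs i] the same value 0 as at [x], whereas it is
    positive there. *)
Lemma ratio_seq_residual us xs : ratio_seq xs ->
  (forall j, (j < size us)%N -> dot hf.1 (nth (@vzero n) us j) = 0) ->
  forall i, norm (residual us (size us) (vsub (xs i) x)) <> 0.
Proof.
move=> [_ _ pos _] perp i /norm0_eq0 r0.
have : dot (residual us (size us) (vsub (xs i) x)) hf.1 = 0.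
  by rewrite /dot rsum_eq0 // => c; rewrite r0; ring.
rewrite dot_residual_perp // dotBl.
by have [] := pos i; move: fx; rewrite /ev !(dotC _ hf.1); lra.
Qed.

(** [m] bounds the number of vectors still to be added. Each round extends the frame by one vector
    and stops as soon as [hf] has nonzero derivative along it. *)
Lemma search_frame m us xs : (n <= size us + m)%N -> ratio_seq xs -> frame_along xs x us ->
  (forall j, (j < size us)%N ->
     dot hf.1 (nth (@vzero n) us j) = 0 /\ dot hg.1 (nth (@vzero n) us j) = 0) ->
  exists us', outgoing_tangent X x us'.
Proof.
elim: m us xs => [|m IH] us xs nm rs fr perp.
all: have [phi [u [ge fr']]] := frame_along_extend fr
  (ratio_seq_residual rs (fun j ju => (perp j ju).1)).
  (* With no rounds left, the extension would have more than [n] orthonormal vectors. *)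
  have := orthonormal_size fr'.1; rewrite size_rcons; move: nm; rewrite addn0.
  by move=> le1 le2; have := leq_ltn_trans le1 le2; rewrite ltnn.
have {}rs := ratio_seq_subseq ge rs; set xs' := fun k => xs (phi k) in rs fr'.
set us' := rcons us u in fr'.
have sz : size us' = (size us).+1 by rewrite size_rcons.
have nth' j : (j < size us)%N -> nth (@vzero n) us' j = nth (@vzero n) us j.
  by move=> ju; rewrite nth_rcons ju.
have nthu : nth (@vzero n) us' (size us) = u by rewrite nth_rcons ltnn eqxx.
have ju : (size us < size us')%N by rewrite sz.
have perpf j : (j < size us)%N -> dot hf.1 (nth (@vzero n) us' j) = 0.
  by move=> lt; rewrite nth' //; case: (perp j lt).
have perpg j : (j < size us)%N -> dot hg.1 (nth (@vzero n) us' j) = 0.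
  by move=> lt; rewrite nth' //; case: (perp j lt).
have cvf := frame_along_directional fr' ju fx perpf.
have cvg := frame_along_directional fr' ju gx perpg.
rewrite nthu in cvf cvg.
have [Xxs cv pos unb] := rs.
have rhop i : 0 < / norm (residual us' (size us) (vsub (xs' i) x)).
  apply: Rinv_0_lt_compat; case: fr' => _ /(_ _ ju)[/(_ i) ne _].
  by case: (norm_ge0 (residual us' (size us) (vsub (xs' i) x))) => // /esym/ne.
have fu0 : 0 <= dot hf.1 u.
  by apply: Un_cv_ge0 cvf _ => i; apply: Rmult_le_pos; have := rhop i; have := pos i; slra.
have gu0 : 0 <= dot hg.1 u.
  by apply: Un_cv_ge0 cvg _ => i; apply: Rmult_le_pos; have := rhop i; have := pos i; slra.
(* Otherwise some multiple [INR p] of this derivative exceeds that of [hf]; then [INR p * ev hg]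
   eventually exceeds [ev hf] along the sequence, against [unb]. *)
have {gu0} gu : dot hg.1 u = 0.
  apply: (scaled_nonneg_eq0 (b := dot hf.1 u)) => // p; apply: Rnot_lt_le => lt.
  have /Un_cv_pos H := CV_minus _ _ _ _ (CV_mult _ _ _ _ (Un_cv_cst (INR p)) cvg) cvf.
  have /H ev1 : 0 < INR p * dot hg.1 u - dot hf.1 u by lra.
  have [N HN] := eventually_and ev1 (unb p); have [] := HN N (leqnn N).
  have := rhop N; move: (/ norm _) => a; snra.
case: (Req_dec (dot hf.1 u) 0) => [fu|fu].
  apply: (IH us' xs') => //; first by rewrite sz addSnnS.
  move=> j; rewrite sz ltnS leq_eqVlt => /orP[/eqP->|lt]; first by rewrite nthu.
  by split; [apply: perpf | apply: perpg].
exists us'; apply: (outgoing_of_frame rs fr'); rewrite ?sz //=.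
- move=> j; rewrite ltnS leq_eqVlt => /orP[/eqP->|lt]; first by rewrite nthu.
  exact: perpg.
- by rewrite nthu; lra.
Qed.

End FrameSearch.

Lemma unbounded_ratio_outgoing_tangent n (X K : vec n -> Prop) (f g : vec n -> R) :
  compact_set X -> (forall x, X x -> K x) ->
  cellwise_affine K f -> cellwise_affine K g ->
  (forall y, 0 <= f y /\ 0 <= g y) ->
  (forall y, X y -> g y = 0 -> f y = 0) ->
  (forall m, exists y, X y /\ INR m * g y < f y) ->
  exists x us, X x /\ outgoing_tangent X x us.
Proof.
move=> cX XK cf cg fg0 zero unb.
have [l [hf [hg [fgE unbl]]]] := unbounded_in_cell cf cg XK fg0 unb.
have [x [Xx near]] := unbounded_near_point cX fg0 unbl.
(* Tying multiple and radius to the same index gives one sequence that converges to [x] and along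
   which [f] eventually exceeds every multiple of [g]. *)
have ex k : exists y, [/\ X y, polyhedron l y, INR k * g y < f y & norm1 (vsub y x) < / INR k.+1].
  by apply: near; apply: Rinv_0_lt_compat; apply: lt_0_INR; apply/ltP.
pose xs k := proj1_sig (constructive_indefinite_description _ (ex k)).
have xsP k : [/\ X (xs k), polyhedron l (xs k), INR k * g (xs k) < f (xs k) &
    norm1 (vsub (xs k) x) < / INR k.+1].
  by rewrite /xs; case: constructive_indefinite_description.
have cv : seq_cv xs x.
  have /Un_cvP c0 := inv_INR_cv0; move=> eps /c0; apply: eventually_imp => k.
  rewrite Rminus_0_r; have [_ _ _] := xsP k; have := Rle_abs (/ INR k.+1).
  have := norm_le_norm1 (vsub (xs k) x).
  by move: (/ INR k.+1) (norm1 _) (norm _) => a b c; slra.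
have lx : polyhedron l x.
  by move=> h hl; apply: Un_cv_ge0 (ev_cv h cv) _ => k; case: (xsP k) => _ /(_ h hl).
have xsE k : f (xs k) = ev hf (xs k) /\ g (xs k) = ev hg (xs k).
  by have [Xk lk _ _] := xsP k; apply: fgE => //; apply: XK.
have unbk (m : nat) : eventually (fun k => INR m * ev hg (xs k) < ev hf (xs k)).
  exists m => k mk; have [_ _ lt _] := xsP k; have [<- <-] := xsE k.
  have : INR m <= INR k by apply: le_INR; apply/leP.
  by have := fg0 (xs k); snra.
have [fxE gxE] := fgE x (XK _ Xx) lx.
(* In the limit, [INR m * g x <= f x] for every [m]. *)
have gx : g x = 0.
  apply: (scaled_nonneg_eq0 (b := f x)); first by case: (fg0 x).
  move=> m; apply: Rnot_lt_le; rewrite fxE gxE => lt.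
  have /Un_cv_pos H := CV_minus _ _ _ _ (CV_mult _ _ _ _ (Un_cv_cst (INR m)) (ev_cv hg cv)) (ev_cv
      hf cv).
  have /H ev1 : 0 < INR m * ev hg x - ev hf x by lra.
  by have [N HN] := eventually_and ev1 (unbk m); have [] := HN N (leqnn N); lra.
have fx := zero x Xx gx; rewrite fxE in fx; rewrite gxE in gx.
have [us out] : exists us, outgoing_tangent X x us.
  apply: (search_frame XK fgE zero fx gx (m := n) (us := [::]) (xs := xs)) => //.
  - split=> // [k|k]; first by case: (xsP k).
    have [_ _ lt _] := xsP k; have [e1 e2] := xsE k.
    by have := fg0 (xs k); have := pos_INR k; rewrite -e1 -e2; snra.
by exists x, us.
Qed.

Theorem theorem5p1 (n : nat) (X K : vec n -> Prop) :
  compact_set X -> (exists x, X x) ->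
  closed_cube K -> (forall x, X x -> K x) ->
  ((exists (x : vec n) (us : seq (vec n)), X x /\ outgoing_tangent X x us)
   <-> ~ strongly_semisimple X K).
Proof.
move=> cX _ cK XK; rewrite (not_strongly_semisimpleP cX cK XK); split.
  by move=> [x [us [_ out]]]; apply: outgoing_tangent_unbounded_ratio out.
move=> [f [g [cf cg fg0 zero unb]]]; exact: (unbounded_ratio_outgoing_tangent cX XK cf cg fg0 zero unb).
Qed.
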